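(* $\mathrm{AoUC}_{[0,1]}^* \equiv_{\mathrm{W}} \mathrm{BRoot}^*$.
   Context: Computable analysis setting: represented spaces; reals represented by rational sequences $(q_n)$ with $|q_n - x| < 2^{-n}$. $f \le_{\mathrm{W}} g$ (Weihrauch reducibility) means there are computable partial maps $H,K$ on names such that for every realizer $G$ of $g$, $p \mapsto H(p, G(K(p)))$ realizes $f$; $\equiv_{\mathrm{W}}$ means reducibility in both directions. $f^*$: given $n\in\mathbb{N}$ and $n$ inputs for $f$, output a tuple of corresponding valid outputs. $\mathrm{AoUC}_{[0,1]}$: input a closed set $A \subseteq [0,1]$ given by an enumeration of rational open intervals exhausting $[0,1]\setminus A$, promised to be either $[0,1]$ or a singleton; output any $x \in A$. Real univariate polynomials are represented by an upper bound on the degree together with the tuple of (real) coefficients up to that bound (so the exact degree is not known). $\mathrm{BRoot}$ maps a real univariate polynomial $p$ to some root of $p$ in $[0,1]$ if $p$ has one there; if $p$ has no root in $[0,1]$, any $x \in [0,1]$ is a valid output. *)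

(* Defs.v *)
From HB Require Import structures.
From mathcomp Require Import all_boot all_order all_algebra.
From mathcomp Require Import all_classical all_reals all_analysis.
From Stdlib Require Cantor List.

Set Implicit Arguments.
Unset Strict Implicit.
Unset Printing Implicit Defensive.

Import Order.TTheory GRing.Theory Num.Theory.
Import numFieldNormedType.Exports.

Local Open Scope classical_set_scope.

Definition baire := nat -> nat.

Definition cpair (m n : nat) : nat := Cantor.to_nat (m, n).
Definition cfst (n : nat) : nat := (Cantor.of_nat n).1.
Definition csnd (n : nat) : nat := (Cantor.of_nat n).2.

(* Codes for the unary functions that are partial recursive relative to an
   oracle; several arguments are passed through the Cantor pairing. *)
Inductive code : Type :=
| Zero | Succ | Fst | Snd | Oracle
| Pair of code & code
| Comp of code & code
| Rec of code & code
| Mu of code.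

(* [ev p c x y]: the computation of [c] with oracle [p] on input [x] halts
   with value [y]. *)
Inductive ev (p : baire) : code -> nat -> nat -> Prop :=
| ev_zero x : ev p Zero x 0
| ev_succ x : ev p Succ x x.+1
| ev_fst x : ev p Fst x (cfst x)
| ev_snd x : ev p Snd x (csnd x)
| ev_oracle x : ev p Oracle x (p x)
| ev_pair f g x a b :
    ev p f x a -> ev p g x b -> ev p (Pair f g) x (cpair a b)
| ev_comp f g x y z :
    ev p g x y -> ev p f y z -> ev p (Comp f g) x z
| ev_rec0 f g x z :
    ev p f x z -> ev p (Rec f g) (cpair x 0) z
| ev_recS f g x n y z :
    ev p (Rec f g) (cpair x n) y -> ev p g (cpair x (cpair n y)) z ->
    ev p (Rec f g) (cpair x n.+1) z
| ev_mu f x n (v : nat -> nat) :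
    (forall m, m < n -> ev p f (cpair x m) (v m).+1) ->
    ev p f (cpair x n) 0 -> ev p (Mu f) x n.

Definition pfun_baire := baire -> option baire.

(* As usual, the machine may also produce output outside the domain of [F]. *)
Definition computable (F : pfun_baire) : Prop :=
  exists c : code, forall p q, F p = Some q -> forall n, ev p c n (q n).

Definition bpair (p q : baire) : baire :=
  fun n => if odd n then q n./2 else p n./2.

(* A name [p] of a tuple carries a number in [p 0]; the remaining positions are
   split into countably many sequences. *)
Definition component (p : baire) (i : nat) : baire :=
  fun n => p (cpair i n).+1.

(* [names p x] is the graph of the representation, a partial surjection from
   Baire space onto the carrier. *)
Record repSpace := RepSpace {
  carrier :> Type;
  names : baire -> carrier -> Prop;
  names_fun : forall p x y, names p x -> names p y -> x = y;
  names_surj : forall x, exists p, names p x }.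

Definition multifun (X Y : repSpace) := X -> Y -> Prop.

Definition mdom (X Y : repSpace) (f : multifun X Y) (x : X) : Prop :=
  exists y, f x y.

Definition realizer (X Y : repSpace) (f : multifun X Y) (F : pfun_baire) :
    Prop :=
  forall p x, names p x -> mdom f x ->
    exists q y, [/\ F p = Some q, names q y & f x y].

Definition weihrauch_le (X Y Z W : repSpace)
    (f : multifun X Y) (g : multifun Z W) : Prop :=
  exists H K : pfun_baire, [/\ computable H, computable K &
    forall G : pfun_baire, realizer g G ->
      realizer f (fun p =>
        obind (fun k => obind (fun q => H (bpair p q)) (G k)) (K p))].

Definition weihrauch_equiv (X Y Z W : repSpace)
    (f : multifun X Y) (g : multifun Z W) : Prop :=
  weihrauch_le f g /\ weihrauch_le g f.

Section Sub.
Variables (X : repSpace) (P : X -> Prop).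

Definition sub_names (p : baire) (x : {x : X | P x}) : Prop :=
  names p (sval x).

Lemma sub_names_fun p x y : sub_names p x -> sub_names p y -> x = y.
Proof. by move=> px py; exact/eq_sig_hprop/(names_fun px py). Qed.

Lemma sub_names_surj x : exists p, sub_names p x.
Proof. exact: names_surj. Qed.

Definition sub_space : repSpace := RepSpace sub_names_fun sub_names_surj.
End Sub.

Section Star.
Variable X : repSpace.

Definition star_names (p : baire) (s : seq X) : Prop :=
  p 0 = size s /\
  forall i x, onth s i = Some x -> names (component p i) x.

Lemma star_names_fun p s t : star_names p s -> star_names p t -> s = t.
Proof.
move=> [ps hs] [pt ht].
have st : size s = size t by rewrite -ps.
apply: eq_from_onth => i.
case Es : (onth s i) => [x|]; case Et : (onth t i) => [y|] //.
- by congr Some; exact: (names_fun (hs _ _ Es) (ht _ _ Et)).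
- by have := onthTE s i; rewrite st -onthTE Es Et.
- by have := onthTE s i; rewrite st -onthTE Es Et.
Qed.

Definition glue (n : nat) (q : nat -> baire) : baire :=
  fun k => if k is k'.+1 then q (cfst k') (csnd k') else n.

Lemma component_glue n q i : component (glue n q) i = q i.
Proof.
apply/funext => k; rewrite /component /glue /cfst /csnd /cpair.
by rewrite Cantor.cancel_of_to.
Qed.

Lemma star_names_surj s : exists p, star_names p s.
Proof.
have /choice[q hq] : forall i, exists q : baire,
    forall x, onth s i = Some x -> names q x.
  move=> i; case: (onth s i) => [x|]; last by exists (fun=> 0).
  by have [q qx] := names_surj x; exists q => _ [<-].
exists (glue (size s) q); split=> // i x six.
by rewrite component_glue; exact: hq.
Qed.

Definition star_space : repSpace :=
  RepSpace star_names_fun star_names_surj.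
End Star.

Definition star (X Y : repSpace) (f : multifun X Y) :
    multifun (star_space X) (star_space Y) :=
  fun xs ys => List.Forall2 f xs ys.

(* The numbering <<i, j>, k> |-> (i - j) / (k + 1) of the rationals. *)
Definition rat_of_code (n : nat) : rat :=
  (((cfst (cfst n))%:Z - (csnd (cfst n))%:Z)%:~R / (csnd n).+1%:R)%R.

Lemma rat_of_code_surj (r : rat) : exists n, rat_of_code n = r.
Proof.
have [i [j ijE]] : exists i j : nat, (i%:Z - j%:Z)%R = numq r.
  case: (numq r) => n; first by exists n, 0; rewrite subr0.
  by exists 0, n.+1; rewrite sub0r NegzE.
exists (cpair (cpair i j) `|denq r|.-1).
rewrite /rat_of_code /cfst /csnd /cpair !Cantor.cancel_of_to /=.
rewrite ijE prednK ?absz_gt0 ?denq_neq0//.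
rewrite -[X in (_ / X)%R]/((`|denq r|%N%:Z)%:~R : rat)%R.
by rewrite absz_denq divq_num_den.
Qed.

Section Spaces.
Variable R : realType.
Local Open Scope ring_scope.

Definition realq (n : nat) : R := ratr (rat_of_code n).

Definition real_names (p : baire) (x : R) : Prop :=
  forall n, `|realq (p n) - x| < 2 ^- n.

Lemma real_names_fun p x y : real_names p x -> real_names p y -> x = y.
Proof.
move=> px py; apply/eqP; rewrite -subr_eq0 -normr_le0 leNgt; apply/negP => xy.
have [n nE] : exists n, (2 : R) ^- n < `|x - y| / 2.
  have [n _ hn] := near_infty_natSinv_expn_lt (PosNum (divr_gt0 xy (ltr0Sn R 1))).
  by exists n; have := hn n (leqnn n); rewrite /= div1r.
have := ltrD (px n) (py n).
rewrite ltNge => /negP; apply.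
rewrite (distrC (realq _) x) (le_trans _ (ler_distD (realq (p n)) x y))//.
by rewrite (splitr `|x - y|) lerD // ltW.
Qed.

Lemma real_names_surj x : exists p, real_names p x.
Proof.
have /choice[p hp] : forall n, exists k, `|realq k - x| < 2 ^- n.
  move=> n; have h : x - 2 ^- n < x + 2 ^- n.
    by rewrite ltrD2l gtrN // invr_gt0 exprn_gt0.
  have [q] := rat_in_itvoo h; rewrite in_itv /= => qI.
  have [k kq] := rat_of_code_surj q; exists k.
  by rewrite ltr_distl /realq kq.
by exists p.
Qed.

Definition real_space : repSpace := RepSpace real_names_fun real_names_surj.

Definition unit_space : repSpace :=
  @sub_space real_space (fun x : R => 0 <= x <= 1).

Definition closed_unit :=
  {A : set R | closed A /\ A `<=` [set` `[(0 : R), 1]]}.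

(* Negative information: [p] enumerates rational open intervals whose union
   covers exactly [0,1] \ A within [0,1].  Intervals may stick out of [0,1], and
   codes with left end >= right end denote the empty interval. *)
Definition closed_names (p : baire) (A : closed_unit) : Prop :=
  forall x : R, 0 <= x <= 1 ->
    (~ sval A x <->
     exists n, realq (cfst (p n)) < x < realq (csnd (p n))).

Lemma closed_names_fun p A B : closed_names p A -> closed_names p B -> A = B.
Proof.
move=> pA pB; apply: eq_sig_hprop => [? ? ?|]; first exact: Prop_irrelevance.
case: A B pA pB => [A [cA sA]] [B [cB sB]] /= pA pB.
apply/seteqP; split=> x xAB; apply: contrapT => nx.
- have x01 : 0 <= x <= 1 by have := sA _ xAB; rewrite /= in_itv.
  by have /(pA _ x01) := (pB _ x01).1 nx; apply.
- have x01 : 0 <= x <= 1 by have := sB _ xAB; rewrite /= in_itv.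
  by have /(pB _ x01) := (pA _ x01).1 nx; apply.
Qed.

Lemma closed_names_surj A : exists p, closed_names p A.
Proof.
case: A => A [cA sA].
pose ok n := forall y, realq (cfst n) < y < realq (csnd n) -> ~ A y.
pose e := cpair 0 0.
have eE y : ~ (realq (cfst e) < y < realq (csnd e)).
  rewrite /e /cfst /csnd /cpair Cantor.cancel_of_to /= => /andP[a b].
  by have := lt_trans a b; rewrite ltxx.
exists (fun n => if `[< ok n >] then n else e) => x x01 /=; split.
- move=> nAx.
  have : nbhs x (~` A) by apply: open_nbhs_nbhs; split=> //; exact: closed_openC.
  move=> /nbhs_ballP[d /= d0 dA].
  have [q1] : exists q, ratr q \in `]x - d, x[.
    by apply: rat_in_itvoo; rewrite ltrBlDr ltrDl.
  have [q2] : exists q, ratr q \in `]x, x + d[.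
    by apply: rat_in_itvoo; rewrite ltrDl.
  rewrite !in_itv /= => /andP[xq2 q2d] /andP[dq1 q1x].
  have [k1 k1E] := rat_of_code_surj q1; have [k2 k2E] := rat_of_code_surj q2.
  have fE : realq (cfst (cpair k1 k2)) = ratr q1.
    by rewrite /cfst /cpair Cantor.cancel_of_to /realq k1E.
  have sE : realq (csnd (cpair k1 k2)) = ratr q2.
    by rewrite /csnd /cpair Cantor.cancel_of_to /realq k2E.
  exists (cpair k1 k2); case: asboolP => [_|]; first by rewrite fE sE q1x.
  case=> y; rewrite fE sE => /andP[q1y yq2]; apply: dA.
  rewrite /ball /= distrC ltr_distl (lt_trans dq1 q1y) /=.
  exact: lt_trans yq2 q2d.
- by move=> [n]; case: asboolP => [okn /okn|_ /eE].
Qed.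

Definition closed_space : repSpace :=
  RepSpace closed_names_fun closed_names_surj.

(* [p 0] is an upper bound on the degree ([size f] is the degree plus 1, and 0
   for the zero polynomial), followed by names of all coefficients up to it. *)
Definition poly_names (p : baire) (f : {poly R}) : Prop :=
  (size f <= (p 0%N).+1)%N /\
  forall i, (i <= p 0%N)%N -> real_names (component p i) f`_i.

Lemma poly_names_fun p f g : poly_names p f -> poly_names p g -> f = g.
Proof.
move=> [sf hf] [sg hg]; apply/polyP => i.
have [ip|pi] := leqP i (p 0%N); first exact: real_names_fun (hf _ ip) (hg _ ip).
by rewrite !nth_default // ?(leq_trans sf) ?(leq_trans sg).
Qed.

Lemma poly_names_surj f : exists p, poly_names p f.
Proof.
have /choice[q hq] : forall i, exists q, real_names q f`_i.
  by move=> i; exact: real_names_surj.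
exists (glue (size f) q); split=> [|i _]; first exact: leqnSn.
by rewrite component_glue.
Qed.

Definition poly_space : repSpace := RepSpace poly_names_fun poly_names_surj.

Definition AoUC : multifun closed_space unit_space :=
  fun A x =>
    (sval A = [set` `[(0 : R), 1]] \/ exists a : R, sval A = [set a]) /\
    sval A (sval x).

Definition BRoot : multifun poly_space unit_space :=
  fun (f : {poly R}) x =>
    (exists2 r : R, 0 <= r <= 1 & root f r) -> root f (sval x).

End Spaces.

(* Main.v *)
Require Import Defs.
From mathcomp Require Import all_boot all_order all_algebra.
From mathcomp Require Import all_classical all_reals all_analysis.
From mathcomp Require Import complex ring lra zify.

(** [AoUC* <= BRoot*].  Let [t] be the first stage at which an interval meeting
    [0,1] is enumerated.  The set is the zero set in [0,1] of [2^-t (X - a)],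
    or of [0] if nothing is ever removed.  The coefficients may be announced as
    [0] up to precision [2^-t]; beyond it the set is known to be a singleton
    [{a}], and compactness locates [a].

    [BRoot* <= AoUC*].  A polynomial [f] of degree at most [N] is proportional to
    a product of [N] factors [u X - v] with [u >= 0] and [max (u, |v|^2) = 1],
    sorted by the value of [u * Re v].  If [f <> 0], these values do not depend
    on the factorisation and every root of [f] in [0,1] is one of them; if
    [f = 0], they can be any number of [0,1].  So the [N] candidates
    [r_j = max (u_j * Re v_j, 0)] are instances of AoUC.  With [m_j = |f (r_j)|]
    and [P_j = m_0 ... m_(j-1)], the equations [t (P_j + m_j) = P_j] are [N]
    further instances: [t > 0] entails [m_j = 0] as soon as one of
    [m_0, ..., m_j] is [0], and [t < 1] entails that one of [m_0, ..., m_(j-1)]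
    is [0] in that case; hence they point to a candidate that is a root.  These
    instances are projections of zero sets of Lipschitz functions on a cube, so
    their complements are enumerated by a search over finer and finer grids. *)

Set Implicit Arguments.
Unset Strict Implicit.
Unset Printing Implicit Defensive.

Import Order.TTheory GRing.Theory Num.Theory.
Import numFieldNormedType.Exports.
Local Open Scope classical_set_scope.

(** * Effective maps between numbered types *)

(** As the exact degree is unknown, leading coefficients may vanish and roots may escape to
    infinity; normalising the factors [u X - v] keeps them in a compact set. For [u <> 0] the sign
    of [u] fixes the phase of a factor; for [u = 0] the phase stays free, but then the key
    [u * Re v] is [0]. So the key is a function of the root alone, continuous up to infinity, and it
    equals [z] for a root [z] in [0,1] because [u = 1] there. Roots carry no order of their own;
    sorting by the key provides one.

    A reduction asks all its instances at once, so the instances that choose a candidate cannot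
    refer to the answers for the candidates. They refer to the hidden factorisation instead, which
    is harmless because the [m_j] are the same for all factorisations, even for [f = 0]. Whether
    [m_j = 0] is undecidable, whereas a coarse approximation of [t] settles one of [t > 0] and
    [t < 1]; this dictates the form of the choice equations.

    Every condition is evaluated exactly at rational points, hence [|v|^2] instead of [|v|] in the
    normalisation. *)

Class numbered (T : Type) := decode : nat -> T.

#[global] Instance numbered_nat : numbered nat := id.
#[global] Instance numbered_bool : numbered bool := fun n => n != 0.
#[global] Instance numbered_rat : numbered rat := rat_of_code.
#[global] Instance numbered_prod A B (nA : numbered A) (nB : numbered B) :
  numbered (A * B) := fun n => (decode (cfst n), decode (csnd n)).

(** The code must halt for every oracle and every input, so such maps compose freely; partial
    functionals enter only through the unbounded search of [eff_search]. *)
Definition eff {X T} {nX : numbered X} {nT : numbered T}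
    (f : baire -> X -> T) : Prop :=
  exists c, forall p n, exists2 y, ev p c n y & decode y = f p (decode n).

Lemma cfst_pair a b : cfst (cpair a b) = a.
Proof. by rewrite /cfst /cpair Cantor.cancel_of_to. Qed.

Lemma csnd_pair a b : csnd (cpair a b) = b.
Proof. by rewrite /csnd /cpair Cantor.cancel_of_to. Qed.

Lemma cpairK n : cpair (cfst n) (csnd n) = n.
Proof.
by rewrite /cpair /cfst /csnd -surjective_pairing Cantor.cancel_to_of.
Qed.

Lemma decode_pair A B (nA : numbered A) (nB : numbered B) a b :
  decode (cpair a b) = (decode a, decode b) :> A * B.
Proof. by rewrite {1}/decode /numbered_prod cfst_pair csnd_pair. Qed.

Section Eff.
Context {X Y Z T : Type} {nX : numbered X} {nY : numbered Y} {nZ : numbered Z}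
  {nT : numbered T}.

Lemma eff_ext (f g : baire -> X -> T) :
  (forall p x, f p x = g p x) -> eff f -> eff g.
Proof.
move=> fg [c hc]; exists c => p n; have [y ? E] := hc p n.
by exists y; rewrite // E fg.
Qed.

Lemma eff_id : eff (fun _ (x : X) => x).
Proof.
exists (Pair Fst Snd) => p n; exists n => //.
by rewrite -{2}(cpairK n); apply: ev_pair; constructor.
Qed.

Lemma eff_comp (f : baire -> X -> Y) (g : baire -> Y -> Z) :
  eff f -> eff g -> eff (fun p x => g p (f p x)).
Proof.
move=> [c hc] [d hd]; exists (Comp d c) => p n.
have [y cy yE] := hc p n; have [z dz zE] := hd p y.
by exists z; [exact: ev_comp cy dz|rewrite zE yE].
Qed.

Lemma eff_pair (f : baire -> X -> Y) (g : baire -> X -> Z) :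
  eff f -> eff g -> eff (fun p x => (f p x, g p x)).
Proof.
move=> [c hc] [d hd]; exists (Pair c d) => p n.
have [y cy yE] := hc p n; have [z dz zE] := hd p n.
exists (cpair y z); first exact: ev_pair.
by rewrite decode_pair yE zE.
Qed.

Lemma eff_fst (f : baire -> X -> Y * Z) : eff f -> eff (fun p x => (f p x).1).
Proof.
move=> [c hc]; exists (Comp Fst c) => p n; have [y cy yE] := hc p n.
by exists (cfst y); [exact/(ev_comp cy)/ev_fst|rewrite -yE].
Qed.

Lemma eff_snd (f : baire -> X -> Y * Z) : eff f -> eff (fun p x => (f p x).2).
Proof.
move=> [c hc]; exists (Comp Snd c) => p n; have [y cy yE] := hc p n.
by exists (csnd y); [exact/(ev_comp cy)/ev_snd|rewrite -yE].
Qed.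

Lemma eff_const_code n : eff (fun _ (_ : X) => decode n : T).
Proof.
suff [c hc] : exists c, forall p m, ev p c m n.
  by exists c => p m; exists n.
elim: n => [|n [c hc]]; first by exists Zero => p m; constructor.
by exists (Comp Succ c) => p m; apply: ev_comp (hc _ _) _; constructor.
Qed.

Lemma eff_nat_rect (a : baire -> X -> T) (h : baire -> X -> nat)
    (g : baire -> X -> nat -> T -> T) :
  eff a -> eff (fun p (z : X * (nat * T)) => g p z.1 z.2.1 z.2.2) -> eff h ->
  eff (fun p x => nat_rect (fun=> T) (a p x) (g p x) (h p x)).
Proof.
move=> [ca ha] [cg hg] [ch hh].
(* [Pair Fst Snd] computes the identity, so the argument is kept beside the number of iterations, in
   the shape that [Rec] expects. *)
exists (Comp (Rec ca cg) (Pair (Pair Fst Snd) ch)) => p x.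
have [n ev_n nE] := hh p x.
suff [y ev_y yE] : exists2 y, ev p (Rec ca cg) (cpair x n) y &
    @decode T nT y = nat_rect (fun=> T) (a p (@decode X nX x)) (g p (@decode X nX x)) n.
  exists y; last by rewrite yE -nE.
  apply: ev_comp ev_y; apply: ev_pair => //.
  by rewrite -{2}(cpairK x); apply: ev_pair; constructor.
elim: {ev_n nE} n => [|n [y IHy yE]].
  have [y ey yE] := ha p x; exists y; last by rewrite yE.
  exact: ev_rec0 ey.
have [z ev_z zE] := hg p (cpair x (cpair n y)).
exists z; first exact: ev_recS ev_z.
by rewrite zE !decode_pair yE.
Qed.

End Eff.

Section EffNat.
Context {X : Type} {nX : numbered X}.
Implicit Types f g h : baire -> X -> nat.

Lemma eff_nat (n : nat) : eff (fun _ (_ : X) => n).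
Proof. exact (@eff_const_code X nat nX numbered_nat n). Qed.

Lemma eff_bool (b : bool) : eff (fun _ (_ : X) => b).
Proof.
by case: b; [exact (@eff_const_code X bool nX numbered_bool 1)
  |exact (@eff_const_code X bool nX numbered_bool 0)].
Qed.

Lemma eff_rat (q : rat) : eff (fun _ (_ : X) => q).
Proof.
by have [n <-] := rat_of_code_surj q; exact (@eff_const_code X rat nX numbered_rat n).
Qed.

Lemma eff_succ f : eff f -> eff (fun p x => (f p x).+1).
Proof.
move=> [c hc]; exists (Comp Succ c) => p n; have [y cy yE] := hc p n.
by exists y.+1; [exact/(ev_comp cy)/ev_succ|rewrite -yE].
Qed.

Lemma eff_oracle f : eff f -> eff (fun p x => p (f p x)).
Proof.
move=> [c hc]; exists (Comp Oracle c) => p n; have [y cy yE] := hc p n.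
by exists (p y); [exact/(ev_comp cy)/ev_oracle|rewrite -yE].
Qed.

Lemma eff_cpair f g : eff f -> eff g -> eff (fun p x => cpair (f p x) (g p x)).
Proof.
move=> [c hc] [d hd]; exists (Pair c d) => p n.
have [y cy yE] := hc p n; have [z dz zE] := hd p n.
by exists (cpair y z); [exact: ev_pair|rewrite -yE -zE].
Qed.

Lemma eff_cfst f : eff f -> eff (fun p x => cfst (f p x)).
Proof.
move=> [c hc]; exists (Comp Fst c) => p n; have [y cy yE] := hc p n.
by exists (cfst y); [exact/(ev_comp cy)/ev_fst|rewrite -yE].
Qed.

Lemma eff_csnd f : eff f -> eff (fun p x => csnd (f p x)).
Proof.
move=> [c hc]; exists (Comp Snd c) => p n; have [y cy yE] := hc p n.
by exists (csnd y); [exact/(ev_comp cy)/ev_snd|rewrite -yE].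
Qed.

Lemma eff_rat_of_code f : eff f -> eff (fun p x => rat_of_code (f p x)).
Proof. by move=> [c hc]; exists c => p n; have [y ? <-] := hc p n; exists y. Qed.

Lemma eff_neq0 f : eff f -> eff (fun p x => f p x != 0).
Proof. by move=> [c hc]; exists c => p n; have [y ? <-] := hc p n; exists y. Qed.

End EffNat.

(** The branching is a recursion iterated as often as the code of the boolean says: no round leaves
    [g], any positive number of rounds gives [f]. *)
Lemma eff_if {X T} {nX : numbered X} {nT : numbered T} (b : baire -> X -> bool)
    (f g : baire -> X -> T) :
  eff b -> eff f -> eff g -> eff (fun p x => if b p x then f p x else g p x).
Proof.
move=> [cb hb] ef eg.
have [c hc] : eff (fun p (z : X * nat) =>
    nat_rect (fun=> T) (g p z.1) (fun _ _ => f p z.1) z.2).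
  apply: eff_nat_rect; last exact/eff_snd/eff_id.
  - exact: (eff_comp (eff_fst eff_id) eg).
  - exact: (eff_comp (eff_fst (eff_fst eff_id)) ef).
exists (Comp c (Pair (Pair Fst Snd) cb)) => p n.
have [k ev_k kE] := hb p n.
have [y ev_y yE] := hc p (cpair n k).
exists y.
  apply: ev_comp ev_y; apply: ev_pair => //.
  by rewrite -{2}(cpairK n); apply: ev_pair; constructor.
by rewrite yE -kE decode_pair /decode /numbered_nat /numbered_bool; case: (k).
Qed.

Ltac eff_step := first
  [ exact: eff_id | exact: eff_nat | exact: eff_bool | exact: eff_rat
  | assumption
  | apply: eff_succ | apply: eff_cpair | apply: eff_cfst | apply: eff_csnd
  | apply: eff_rat_of_code
  | apply: eff_if | apply: eff_nat_rect | apply: eff_oracle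
  | apply: eff_fst | apply: eff_snd | apply: eff_pair ].
Ltac eff := repeat eff_step.

Lemma eff_app1 {X} {nX : numbered X} {Y T} {nY : numbered Y} {nT : numbered T}
    (op : Y -> T)
    (f : baire -> X -> Y) :
  eff (fun _ y => op y) -> eff f -> eff (fun p x => op (f p x)).
Proof. by move=> eo ef; exact: (eff_comp ef eo). Qed.

Lemma eff_app2 {X} {nX : numbered X} {Y Z T} {nY : numbered Y} {nZ : numbered Z}
    {nT : numbered T}
    (op : Y -> Z -> T) (f : baire -> X -> Y) (g : baire -> X -> Z) :
  eff (fun _ z => op z.1 z.2) -> eff f -> eff g ->
  eff (fun p x => op (f p x) (g p x)).
Proof. by move=> eo ef eg; exact: (eff_comp (eff_pair ef eg) eo). Qed.

(** * Arithmetic of natural numbers, booleans and bounded quantifiers *)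

Lemma eff_addn {X} {nX : numbered X} (f g : baire -> X -> nat) : eff f -> eff g -> eff
    (fun p x => f p x + g p x).
Proof.
apply: eff_app2.
apply: (eff_ext (f := fun p z => nat_rect (fun=> nat) z.1 (fun _ y => y.+1) z.2)).
  by move=> _ [a b] /=; elim: b => [|b /= ->]; rewrite ?addn0 ?addnS.
by eff.
Qed.

Lemma eff_predn {X} {nX : numbered X} (f : baire -> X -> nat) : eff f -> eff
    (fun p x => (f p x).-1).
Proof.
apply: eff_app1.
apply: (eff_ext (f := fun p z => nat_rect (fun=> nat) 0 (fun i _ => i) z)).
  by move=> _ [|n].
by eff.
Qed.

Lemma eff_subn {X} {nX : numbered X} (f g : baire -> X -> nat) : eff f -> eff g -> eff
    (fun p x => f p x - g p x).
Proof.
apply: eff_app2.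
apply: (eff_ext (f := fun p z => nat_rect (fun=> nat) z.1 (fun _ y => y.-1) z.2)).
  by move=> _ [a b] /=; elim: b => [|b /= ->]; rewrite ?subn0 ?subnS.
by do ![apply: eff_predn|eff_step].
Qed.

Lemma eff_muln {X} {nX : numbered X} (f g : baire -> X -> nat) : eff f -> eff g -> eff
    (fun p x => f p x * g p x).
Proof.
apply: eff_app2.
apply: (eff_ext (f := fun p z => nat_rect (fun=> nat) 0 (fun _ y => y + z.1) z.2)).
  by move=> _ [a b] /=; elim: b => [|b /= ->]; rewrite ?muln0 // mulnS addnC.
by do ![apply: eff_addn|eff_step].
Qed.

Lemma eff_leq {X} {nX : numbered X} (f g : baire -> X -> nat) : eff f -> eff g -> eff
    (fun p x => f p x <= g p x).
Proof.
move=> ef eg;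
  apply: (eff_ext (f := fun p x => if f p x - g p x != 0 then false else true)).
  by move=> p x; rewrite -subn_eq0; case: eqP.
by do ![apply: eff_subn|apply: eff_neq0|eff_step].
Qed.

Lemma eff_eqn {X} {nX : numbered X} (f g : baire -> X -> nat) : eff f -> eff g -> eff
    (fun p x => f p x == g p x).
Proof.
move=> ef eg;
  apply: (eff_ext (f := fun p x => if f p x <= g p x then g p x <= f p x else false)).
  by move=> p x; rewrite eqn_leq; case: leqP.
by do ![apply: eff_leq|eff_step].
Qed.

Lemma eff_expn {X} {nX : numbered X} (f g : baire -> X -> nat) : eff f -> eff g -> eff
    (fun p x => f p x ^ g p x).
Proof.
apply: eff_app2.
apply: (eff_ext (f := fun p z => nat_rect (fun=> nat) 1 (fun _ y => z.1 * y) z.2)).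
  by move=> _ [a b] /=; elim: b => [|b /= ->]; rewrite ?expn0 // expnS.
by do ![apply: eff_muln|eff_step].
Qed.

Lemma eff_sumn {X} {nX : numbered X} (h : baire -> X -> nat)
    (F : baire -> X -> nat -> nat) :
  eff h -> eff (fun p (z : X * nat) => F p z.1 z.2) ->
  eff (fun p x => \sum_(0 <= i < h p x) F p x i).
Proof.
move=> eh [c hc].
have eF : eff (fun p (z : X * nat) => F p z.1 z.2) by exists c.
apply: (eff_ext (f := fun p x =>
  nat_rect (fun=> nat) 0 (fun i y => y + F p x i) (h p x))).
  move=> p x; elim: (h p x) => [|n IHn]; first by rewrite big_geq.
  by rewrite big_nat_recr //= IHn.
apply: eff_nat_rect => //; first exact: eff_nat.
apply: eff_addn; first by eff.
by apply: (eff_comp (f := fun p z => (z.1, z.2.1)) _ eF); eff.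
Qed.

Lemma eff_divn {X} {nX : numbered X} (f g : baire -> X -> nat) : eff f -> eff g -> eff
    (fun p x => f p x %/ g p x).
Proof.
apply: eff_app2.
(* The quotient of [m] by [d > 0] is the number of [i < m] with [(i + 1) d <= m]. *)
apply: (eff_ext (f := fun p z => if z.2 == 0 then 0 else
   \sum_(0 <= i < z.1) if i.+1 * z.2 <= z.1 then 1 else 0)).
  move=> _ [m d] /=; case: eqP => [->|/eqP]; first by rewrite divn0.
  rewrite -lt0n => d0; rewrite -big_mkcond sum1_count.
  rewrite (eq_count (a2 := fun i => i < m %/ d)); last by move=> i /=;
    rewrite leq_divRL.
  rewrite /index_iota subn0 -size_filter.
  have -> : [seq i <- iota 0 m | i < m %/ d] = iota 0 (m %/ d).
    by rewrite -[m %/ d in LHS]add0n filter_iota_ltn // leq_div.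
  by rewrite size_iota.
by do ![apply: eff_leq|apply: eff_eqn|apply: eff_sumn|apply: eff_muln|eff_step].
Qed.

Lemma eff_modn {X} {nX : numbered X} (f g : baire -> X -> nat) : eff f -> eff g -> eff
    (fun p x => f p x %% g p x).
Proof.
apply: eff_app2.
apply: (eff_ext (f := fun p z => z.1 - z.1 %/ z.2 * z.2)).
  by move=> _ [m d] /=; rewrite {1}(divn_eq m d) addKn.
by do ![apply: eff_subn|apply: eff_divn|apply: eff_muln|eff_step].
Qed.

Lemma eff_negb {X} {nX : numbered X} (b : baire -> X -> bool) : eff b -> eff
    (fun p x => ~~ b p x).
Proof.
move=> eb; apply: (eff_ext (f := fun p x => if b p x then false else true)).
  by move=> p x; case: (b p x).
by eff.
Qed.

Lemma eff_andb {X} {nX : numbered X} (b c : baire -> X -> bool) :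
  eff b -> eff c -> eff (fun p x => b p x && c p x).
Proof.
move=> eb ec; apply: (eff_ext (f := fun p x => if b p x then c p x else false)).
  by move=> p x; case: (b p x).
by eff.
Qed.

Lemma eff_orb {X} {nX : numbered X} (b c : baire -> X -> bool) :
  eff b -> eff c -> eff (fun p x => b p x || c p x).
Proof.
move=> eb ec; apply: (eff_ext (f := fun p x => if b p x then true else c p x)).
  by move=> p x; case: (b p x).
by eff.
Qed.

Lemma eff_all {X} {nX : numbered X} (h : baire -> X -> nat)
    (F : baire -> X -> nat -> bool) :
  eff h -> eff (fun p (z : X * nat) => F p z.1 z.2) ->
  eff (fun p x => all (F p x) (iota 0 (h p x))).
Proof.
move=> eh eF.
apply: (eff_ext (f := fun p x =>
  nat_rect (fun=> bool) true (fun i y => y && F p x i) (h p x))).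
  move=> p x; elim: (h p x) => [|n IHn] //.
  by rewrite -[in RHS]addn1 iotaD all_cat /= IHn andbT.
apply: eff_nat_rect => //; first exact: eff_bool.
apply: eff_andb; first by eff.
by apply: (eff_comp (f := fun p z => (z.1, z.2.1)) _ eF); eff.
Qed.

Lemma eff_has {X} {nX : numbered X} (h : baire -> X -> nat)
    (F : baire -> X -> nat -> bool) :
  eff h -> eff (fun p (z : X * nat) => F p z.1 z.2) ->
  eff (fun p x => has (F p x) (iota 0 (h p x))).
Proof.
move=> eh eF; apply: (eff_ext (f := fun p x =>
   ~~ all (fun i => ~~ F p x i) (iota 0 (h p x)))).
  by move=> p x; rewrite -has_predC; apply: eq_has => i /=; rewrite negbK.
by apply: eff_negb; apply: eff_all => //; apply: eff_negb.
Qed.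

Local Open Scope ring_scope.

(** * Rational arithmetic on codes *)

Lemma eff_natr {X} {nX : numbered X} (f : baire -> X -> nat) : eff f -> eff
    (fun p x => (f p x)%:R : rat).
Proof.
move=> ef.
apply: (eff_ext (f := fun p x => rat_of_code (cpair (cpair (f p x) 0) 0))); last by eff.
by move=> p x; rewrite /rat_of_code !(cfst_pair, csnd_pair) subr0 divr1.
Qed.

Lemma eff_rat_op2 {X} {nX : numbered X} (op : rat -> rat -> rat)
    (F : nat -> nat -> nat) (f g : baire -> X -> rat) :
  (forall m n, rat_of_code (F m n) = op (rat_of_code m) (rat_of_code n)) ->
  eff (fun _ (z : nat * nat) => F z.1 z.2) ->
  eff f -> eff g -> eff (fun p x => op (f p x) (g p x)).
Proof.
move=> FE [cF hF]; apply: eff_app2.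
exists cF => p n; have [y ev_y yE] := hF p n.
exists y => //; transitivity (rat_of_code (@decode nat numbered_nat y)) => //.
by rewrite yE; exact: FE.
Qed.

Lemma eff_rat_rel2 {X} {nX : numbered X} (op : rat -> rat -> bool)
    (F : nat -> nat -> bool) (f g : baire -> X -> rat) :
  (forall m n, F m n = op (rat_of_code m) (rat_of_code n)) ->
  eff (fun _ (z : nat * nat) => F z.1 z.2) ->
  eff f -> eff g -> eff (fun p x => op (f p x) (g p x)).
Proof.
move=> FE [cF hF]; apply: eff_app2.
exists cF => p n; have [y ev_y yE] := hF p n.
by exists y => //; rewrite yE; exact: FE.
Qed.

Lemma rat_of_code_cpair i j k :
  rat_of_code (cpair (cpair i j) k) = (i%:R - j%:R) / k.+1%:R.
Proof. by rewrite /rat_of_code !(cfst_pair, csnd_pair) rmorphB. Qed.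

Lemma rat_of_codeE n : rat_of_code n =
  ((cfst (cfst n))%:R - (csnd (cfst n))%:R) / (csnd n).+1%:R.
Proof. by rewrite -{1}(cpairK n) -{1}(cpairK (cfst n)) rat_of_code_cpair. Qed.

Ltac eff_nat_step := first
  [apply: eff_addn | apply: eff_muln | apply: eff_subn | apply: eff_predn
  | apply: eff_leq | eff_step].

Lemma eff_addr {X} {nX : numbered X} (f g : baire -> X -> rat) : eff f -> eff g -> eff
    (fun p x => f p x + g p x).
Proof.
apply: (eff_rat_op2 (F := fun m n => cpair
  (cpair (cfst (cfst m) * (csnd n).+1 + cfst (cfst n) * (csnd m).+1)
         (csnd (cfst m) * (csnd n).+1 + csnd (cfst n) * (csnd m).+1))
  ((csnd m).+1 * (csnd n).+1).-1)); last by do !eff_nat_step.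
move=> m n; rewrite rat_of_code_cpair !rat_of_codeE prednK //.
rewrite !(natrD, natrM).
have : (csnd m).+1%:R != 0 :> rat by rewrite pnatr_eq0.
have : (csnd n).+1%:R != 0 :> rat by rewrite pnatr_eq0.
move: (csnd n).+1%:R (csnd m).+1%:R => a b a0 b0.
by field; rewrite a0 b0.
Qed.

Lemma eff_mulr {X} {nX : numbered X} (f g : baire -> X -> rat) : eff f -> eff g -> eff
    (fun p x => f p x * g p x).
Proof.
apply: (eff_rat_op2 (F := fun m n => cpair
  (cpair (cfst (cfst m) * cfst (cfst n) + csnd (cfst m) * csnd (cfst n))
         (cfst (cfst m) * csnd (cfst n) + csnd (cfst m) * cfst (cfst n)))
  ((csnd m).+1 * (csnd n).+1).-1)); last by do !eff_nat_step.
move=> m n; rewrite rat_of_code_cpair !rat_of_codeE prednK //.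
rewrite !(natrD, natrM).
have : (csnd m).+1%:R != 0 :> rat by rewrite pnatr_eq0.
have : (csnd n).+1%:R != 0 :> rat by rewrite pnatr_eq0.
move: (csnd n).+1%:R (csnd m).+1%:R => a b a0 b0.
by field; rewrite a0 b0.
Qed.

Lemma eff_oppr {X} {nX : numbered X} (f : baire -> X -> rat) : eff f -> eff
    (fun p x => - f p x).
Proof.
move=> ef; apply: (eff_ext (f := fun p x => (-1) * f p x)).
  by move=> p x; rewrite mulN1r.
by apply: eff_mulr => //; exact: eff_rat.
Qed.

Lemma eff_ler {X} {nX : numbered X} (f g : baire -> X -> rat) : eff f -> eff g -> eff
    (fun p x => f p x <= g p x).
Proof.
apply: (eff_rat_rel2 (F := fun m n =>
  cfst (cfst m) * (csnd n).+1 + csnd (cfst n) * (csnd m).+1 <=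
  cfst (cfst n) * (csnd m).+1 + csnd (cfst m) * (csnd n).+1)%N);
    last by do !eff_nat_step.
move=> m n; rewrite !rat_of_codeE ler_pdivrMr ?ltr0Sn // mulrAC ler_pdivlMr ?ltr0Sn //.
rewrite !mulrBl lerBlDr addrAC lerBrDr -!natrM -!natrD ler_nat.
by [].
Qed.

Lemma eff_ltr {X} {nX : numbered X} (f g : baire -> X -> rat) : eff f -> eff g -> eff
    (fun p x => f p x < g p x).
Proof.
move=> ef eg; apply: (eff_ext (f := fun p x => ~~ (g p x <= f p x))).
  by move=> p x; rewrite ltNge.
by apply: eff_negb; apply: eff_ler.
Qed.

Lemma eff_maxr {X} {nX : numbered X} (f g : baire -> X -> rat) : eff f -> eff g -> eff
    (fun p x => Num.max (f p x) (g p x)).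
Proof. by move=> ef eg; apply: eff_if => //; apply: eff_ltr. Qed.

Lemma eff_normr {X} {nX : numbered X} (f : baire -> X -> rat) : eff f -> eff
    (fun p x => `|f p x|).
Proof.
move=> ef; apply: (eff_ext (f := fun p x => Num.max (f p x) (- f p x))).
  by move=> p x; rewrite maxrN.
by apply: eff_maxr => //; apply: eff_oppr.
Qed.

Lemma eff_exprn {X} {nX : numbered X} (f : baire -> X -> rat) (h : baire -> X -> nat) :
  eff f -> eff h -> eff (fun p x => f p x ^+ h p x).
Proof.
apply: eff_app2.
apply: (eff_ext (f := fun p z => nat_rect (fun=> rat) 1 (fun _ y => z.1 * y) z.2)).
  by move=> _ [a b] /=; elim: b => [|b /= ->]; rewrite ?expr0 // exprS.
by do ![apply: eff_mulr|eff_step].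
Qed.

Lemma eff_sumr {X} {nX : numbered X} (h : baire -> X -> nat)
    (F : baire -> X -> nat -> rat) :
  eff h -> eff (fun p (z : X * nat) => F p z.1 z.2) ->
  eff (fun p x => \sum_(0 <= i < h p x) F p x i).
Proof.
move=> eh eF.
apply: (eff_ext (f := fun p x =>
  nat_rect (fun=> rat) 0 (fun i y => y + F p x i) (h p x))).
  move=> p x; elim: (h p x) => [|n IHn]; first by rewrite big_geq.
  by rewrite big_nat_recr //= IHn.
apply: eff_nat_rect => //; first exact: eff_rat.
apply: eff_addr; first by eff.
by apply: (eff_comp (f := fun p z => (z.1, z.2.1)) _ eF); eff.
Qed.

Lemma eff_prodr {X} {nX : numbered X} (h : baire -> X -> nat)
    (F : baire -> X -> nat -> rat) :
  eff h -> eff (fun p (z : X * nat) => F p z.1 z.2) ->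
  eff (fun p x => \prod_(0 <= i < h p x) F p x i).
Proof.
move=> eh eF.
apply: (eff_ext (f := fun p x =>
  nat_rect (fun=> rat) 1 (fun i y => y * F p x i) (h p x))).
  move=> p x; elim: (h p x) => [|n IHn]; first by rewrite big_geq.
  by rewrite big_nat_recr //= IHn.
apply: eff_nat_rect => //; first exact: eff_rat.
apply: eff_mulr; first by eff.
by apply: (eff_comp (f := fun p z => (z.1, z.2.1)) _ eF); eff.
Qed.

Lemma eff_call1 {X Y T} {nX : numbered X} {nY : numbered Y} {nT : numbered T}
    (op : baire -> Y -> T) (f : baire -> X -> Y) :
  eff (fun p y => op p y) -> eff f -> eff (fun p x => op p (f p x)).
Proof. by move=> eo ef; exact: (eff_comp ef eo). Qed.

Lemma eff_call2 {X Y Z T} {nX : numbered X} {nY : numbered Y} {nZ : numbered Z}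
    {nT : numbered T} (op : baire -> Y -> Z -> T) (f : baire -> X -> Y)
    (g : baire -> X -> Z) :
  eff (fun p z => op p z.1 z.2) -> eff f -> eff g ->
  eff (fun p x => op p (f p x) (g p x)).
Proof. by move=> eo ef eg; exact: (eff_comp (eff_pair ef eg) eo). Qed.

Lemma eff_component {X} {nX : numbered X} (f g : baire -> X -> nat) :
  eff f -> eff g -> eff (fun p x => component p (f p x) (g p x)).
Proof. by move=> ef eg; apply: eff_oracle; apply: eff_succ; apply: eff_cpair. Qed.

Lemma eff_computable (f : baire -> nat -> nat) :
  eff f -> computable (fun p => Some (f p)).
Proof.
by move=> [c hc]; exists c => p _ [<-] n; have [y ? <-] := hc p n.
Qed.

(** The code looks for the least witness. The functional is left undefined as soon as one of the
    searches diverges, so the code has to be correct only where all of them succeed. *)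
Lemma eff_search (P : baire -> nat -> nat -> bool) (f : baire -> nat -> nat -> nat) :
  eff (fun p (z : nat * nat) => P p z.1 z.2) ->
  eff (fun p (z : nat * nat) => f p z.1 z.2) ->
  exists2 K, computable K &
    forall p, (forall n, exists m, P p n m) ->
      exists2 q, K p = Some q & forall n, exists2 m, P p n m & q n = f p n m.
Proof.
(* [Mu] stops at the value [0], hence the passage to the negation of [P]. *)
move=> /eff_negb[cP hP] [cf hf].
pose total p := forall n, exists m, P p n m.
pose least p (h : total p) n := ex_minn (h n).
exists (fun p => if pselect (total p) is left h
                 then Some (fun n => f p n (least p h n)) else None).
  exists (Comp cf (Pair (Pair Fst Snd) (Mu cP))) => p q.
  case: pselect => // h [<-] n; rewrite /least; case: ex_minnP => m Pm min_m.
  have [y ev_y yE] := hf p (cpair n m).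
  have -> : f p n m = y by rewrite [RHS]yE decode_pair.
  apply: ev_comp ev_y; apply: ev_pair.
    by rewrite -{2}(cpairK n); apply: ev_pair; constructor.
  have /choice[v hv] k : exists y, ev p cP (cpair n k) y /\ (y != 0) = ~~ P p n k.
    by have [x evx xE] := hP p (cpair n k); exists x; split=> //;
      rewrite [LHS]xE decode_pair.
  apply: (@ev_mu _ _ _ _ (fun k => (v k).-1)) => [k km|].
    have [evk] := hv k; case: (v k) evk => //= _ /esym/negbFE/min_m.
    by rewrite leqNgt km.
  by have [evm] := hv m; rewrite Pm; case: (v m) evm.
move=> p h; case: pselect => // h'; eexists; first by [].
by move=> n /=; rewrite /least; case: ex_minnP => m Pm _; exists m.
Qed.

Ltac eff_all_step := first
  [ exact: eff_id | exact: eff_nat | exact: eff_bool | exact: eff_rat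
  | assumption
  | apply: eff_cpair | apply: eff_cfst | apply: eff_csnd
  | apply: eff_component | apply: eff_rat_of_code
  | apply: eff_all | apply: eff_has
  | apply: eff_maxr | apply: eff_normr | apply: eff_ltr | apply: eff_ler
  | apply: eff_sumr | apply: eff_prodr
  | apply: eff_addr | apply: eff_mulr | apply: eff_oppr | apply: eff_exprn
  | apply: eff_natr
  | apply: eff_sumn | apply: eff_leq
  | apply: eff_addn | apply: eff_muln | apply: eff_subn | apply: eff_predn
  | apply: eff_expn | apply: eff_divn | apply: eff_modn
  | apply: eff_eqn
  | apply: eff_negb | apply: eff_andb | apply: eff_orb
  | apply: eff_succ
  | apply: eff_if | apply: eff_nat_rect | apply: eff_oracle
  | apply: eff_fst | apply: eff_snd | apply: eff_pair ].
Ltac eff ::= repeat eff_all_step.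

(** * From AoUC to BRoot *)

Definition lend (q : baire) (t : nat) : rat := rat_of_code (cfst (q t)).
Definition rend (q : baire) (t : nat) : rat := rat_of_code (csnd (q t)).

Definition hit (q : baire) (t : nat) : bool :=
  (lend q t < rend q t) && ((lend q t < 1) && (0 < rend q t)).

(* The first hit if it is at most [n], and [n.+1] otherwise. *)
Definition hit_time (q : baire) (n : nat) : nat :=
  (\sum_(0 <= t < n.+1)
    if all (fun s => ~~ hit q s) (iota 0 t.+1) then 1 else 0)%N.

Definition grid (m j : nat) : rat := j%:R * (2^-1) ^+ m.

(** A finite certificate that a singleton lies within [2^-n] of [grid m k]. The margin [2^-m] in the
    covering condition absorbs the distance of the unknown point to the grid, and [n < m] makes that
    distance at most [2^-(n+1)], the other half of the error. *)
Definition isolates (q : baire) (n m k : nat) : bool :=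
  (n < m)%N && ((k <= 2 ^ m)%N &&
  all (fun j => (`|grid m j - grid m k| < 2^-1 ^+ n.+1) ||
    has (fun t => (lend q t + 2^-1 ^+ m < grid m j) &&
                  (grid m j < rend q t - 2^-1 ^+ m)) (iota 0 m))
    (iota 0 (2 ^ m).+1)).

Lemma eff_hit {X} {nX : numbered X} (i t : baire -> X -> nat) :
  eff i -> eff t -> eff (fun p x => hit (component p (i p x)) (t p x)).
Proof. by rewrite /hit /lend /rend => ei et; eff. Qed.

Lemma eff_hit_time {X} {nX : numbered X} (i n : baire -> X -> nat) :
  eff i -> eff n -> eff (fun p x => hit_time (component p (i p x)) (n p x)).
Proof.
apply: (eff_call2 (op := fun p i n => hit_time (component p i) n)).
rewrite /hit_time; apply: eff_sumn; first by eff.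
apply: eff_if; [|by eff..]; apply: eff_all; first by eff.
by apply: eff_negb; apply: eff_hit; eff.
Qed.

Lemma eff_isolates {X} {nX : numbered X} (i n m k : baire -> X -> nat) :
  eff i -> eff n -> eff m -> eff k ->
  eff (fun p x => isolates (component p (i p x)) (n p x) (m p x) (k p x)).
Proof.
move=> ei en em ek.
apply: (eff_call2 (op := fun p z w => isolates (component p z.1) z.2 w.1 w.2)
  (f := fun p x => (i p x, n p x)) (g := fun p x => (m p x, k p x))); [|by eff..].
by rewrite /isolates /lend /rend /grid; eff.
Qed.

Lemma hit_timeP q : (forall t, ~~ hit q t) /\ (forall n, hit_time q n = n.+1) \/
  exists2 T, hit q T & forall n, hit_time q n = minn T n.+1.
Proof.
rewrite /hit_time.
have [[t ht]|no] := pselect (exists t, hit q t); last first.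
  left; split=> [t|n]; first by apply/negP => ht; apply: no; exists t.
  under eq_bigr => t _.
    have -> : all (fun s => ~~ hit q s) (iota 0 t.+1).
      by apply/allP => s _; apply/negP => hs; apply: no; exists s.
    over.
  by rewrite sum_nat_const_nat subn0 muln1.
right; have ex : exists t, hit q t by exists t.
exists (ex_minn ex); first by case: ex_minnP.
case: ex_minnP => T hT minT n.
have allE s : all (fun s => ~~ hit q s) (iota 0 s.+1) = (s < T)%N.
  apply/allP/idP => [h|sT j].
    by rewrite ltnNge; apply/negP => Ts; have := h T;
      rewrite mem_iota /= ltnS hT => /(_ Ts).
  rewrite mem_iota /= ?add0n ltnS => js; apply/negP => /minT.
  by rewrite leqNgt (leq_ltn_trans js sT).
under eq_bigr do rewrite allE.
rewrite -big_mkcond sum1_count.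
have [Tn|nT] := leqP T n.+1.
  by rewrite /index_iota ?subn0 -size_filter -[T in X in size X]add0n filter_iota_ltn
    // size_iota.
rewrite (eq_in_count (a2 := predT)) ?count_predT ?size_iota ?subn0 //.
by move=> s; rewrite mem_iota /= ?add0n ?subn0 => sn; rewrite (leq_trans sn) // ltnW.
Qed.

Section Isolation.
Variable R : realType.
Implicit Types (q : baire) (A : closed_unit R) (a : R).

Lemma ratr_grid m k : ratr (grid m k) = k%:R * 2^-1 ^+ m :> R.
Proof. by rewrite /grid rmorphM /= rmorphXn /= fmorphV /= !ratr_nat. Qed.

Lemma ratr_half m : ratr (2^-1 ^+ m) = 2^-1 ^+ m :> R.
Proof. by rewrite rmorphXn /= fmorphV /= ratr_nat. Qed.

Lemma half_exp_gt0 m : 0 < 2^-1 ^+ m :> R.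
Proof. by rewrite exprn_gt0 // invr_gt0. Qed.

Lemma half_expM m : (2 ^ m)%:R * 2^-1 ^+ m = 1 :> R.
Proof. by rewrite natrX -exprMn divff // expr1n. Qed.

Lemma grid_near m (a : R) : 0 <= a <= 1 ->
  exists2 j, (j <= 2 ^ m)%N & `|j%:R * 2^-1 ^+ m - a| < 2^-1 ^+ m.
Proof.
move=> /andP[a0 a1]; have h := half_exp_gt0 m; have h2 := half_expM m.
have b0 : 0 <= a * (2 ^ m)%:R by rewrite mulr_ge0.
have /andP[] := truncn_itv b0.
set j := Num.truncn _ => ja aj.
exists j.
  have : a * (2 ^ m)%:R <= (2 ^ m)%:R by rewrite ler_piMl.
  by move=> /(le_trans ja); rewrite ler_nat.
have aE : a = a * (2 ^ m)%:R * 2^-1 ^+ m by rewrite -mulrA h2 mulr1.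
rewrite {1}aE -mulrBl normrM (gtr0_norm h) -[ltRHS]mul1r ltr_pM2r //.
rewrite distrC ger0_norm ?subr_ge0 // ltrBlDr.
by rewrite addrC -[1]/(1%:R) -natrD addn1.
Qed.

Lemma small_half (e : R) : 0 < e -> \forall m \near \oo, 2^-1 ^+ m < e.
Proof.
move=> e0; have := near_infty_natSinv_expn_lt (PosNum e0).
by apply: filterS => m /=; rewrite div1r exprVn.
Qed.

Lemma isolates_sound q A a n m k : closed_names q A -> sval A = [set a] ->
  isolates q n m k -> `|ratr (grid m k) - a| < 2 ^- n.
Proof.
move=> qA AE /and3P[nm km /allP cov].
have a01 : 0 <= a <= 1.
  by case: A AE {qA} => A [cA sA] /= AE; have := sA a; rewrite AE /= in_itv; apply.
(* Take a grid point next to [a]: were it covered with the margin, [a] itself would have been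
   removed. *)
have [j jm ja] := grid_near m a01.
have := cov j; rewrite mem_iota /= ltnS jm => /(_ isT)/orP[|].
  rewrite -(ltr_rat R) ratr_norm rmorphB /= ratr_half !ratr_grid => jk.
  rewrite (le_lt_trans (ler_distD (j%:R * 2^-1 ^+ m) _ _)) //.
  rewrite (distrC (k%:R * _)).
  have -> : 2 ^- n = 2^-1 ^+ n.+1 + 2^-1 ^+ n.+1 :> R.
    by rewrite exprS exprVn; lra.
  rewrite ltr_leD // (le_trans (ltW ja)) //.
  by rewrite ler_wiXn2l // invf_le1 // ler1n.
move=> /hasP[t _]; rewrite -2!(ltr_rat R) rmorphD rmorphB /= ratr_half !ratr_grid.
move=> /andP[lj jr]; exfalso.
have : ~ sval A a.
  apply/(qA _ a01); exists t.
  move: ja lj jr; rewrite ltr_norml /lend /rend -!/(realq R _) => /andP[ja1 ja2] lj jr.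
  by apply/andP; split; lra.
by apply; rewrite AE.
Qed.

Lemma isolates_complete q A a n : closed_names q A -> sval A = [set a] ->
  exists m k, isolates q n m k.
Proof.
move=> qA AE.
have a01 : 0 <= a <= 1.
  by case: A AE {qA} => A [cA sA] /= AE; have := sA a; rewrite AE /= in_itv; apply.
(* Half the tolerance of the certificate; the other half pays for replacing [a] by a grid point. *)
pose d : R := 2^-1 ^+ n.+1 / 2.
have d0 : 0 < d by rewrite divr_gt0 // half_exp_gt0.
pose P m (x : R) := d <= `|x - a| -> has (fun t =>
  (ratr (lend q t) + 2^-1 ^+ m < x) && (x < ratr (rend q t) - 2^-1 ^+ m)) (iota 0 m).
have cov : \forall m \near \oo, [set` `[(0 : R), 1]] `<=` P m.
  have /compact_near_coveringP := @segment_compact R 0 1.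
  apply=> x /=; rewrite in_itv /= => x01.
  (* Around a point closer than [d] to [a] nothing has to be covered. Any other point lies in an
     enumerated interval; one half of its distance to the ends is spent on moving the point, the
     other on the margin. *)
  have [xa|xa] := ltP `|x - a| d.
    pose e := (d - `|x - a|).
    have e0 : 0 < e by rewrite subr_gt0.
    near=> x' m => /=; rewrite /P => dx'; exfalso.
    have : `|x - x'| < e by near: x'; apply: nbhsx_ballx.
    rewrite /e ltrBrDr; apply/negP; rewrite -leNgt.
    by rewrite (le_trans dx') // (distrC x) ler_distD.
  have : ~ sval A x.
    by rewrite AE /= => xaE; move: xa; rewrite xaE subrr normr0 leNgt d0.
  move=> /(qA _ x01)[t /andP[lt rt]].
  pose e := Num.min (x - ratr (lend q t)) (ratr (rend q t) - x) / 2.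
  have e0 : 0 < e by rewrite divr_gt0 // lt_min !subr_gt0 lt rt.
  near=> x' m => /=; rewrite /P => _.
  have : `|x - x'| < e by near: x'; apply: nbhsx_ballx.
  have me : 2^-1 ^+ m < e by near: m; apply: small_half.
  rewrite ltr_norml => /andP[xx1 xx2].
  have : e * 2 <= x - ratr (lend q t) by rewrite /e divfK // ge_min lexx.
  have : e * 2 <= ratr (rend q t) - x by rewrite /e divfK // ge_min lexx orbT.
  move=> e1 e2; apply/hasP; exists t; last by apply/andP; split; lra.
  by rewrite mem_iota ?add0n /=; near: m; exists t.+1.
have [m [[nm md] Pm]] : exists m, ((n < m)%N /\ 2^-1 ^+ m < d) /\
    [set` `[(0 : R), 1]] `<=` P m.
  have nearm : \forall m \near \oo, (n < m)%N by exists n.+1.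
  have := filterI (filterI nearm (small_half d0)) cov.
  by move=> [m _ /(_ m (leqnn m))]; exists m.
have [k km ka] := grid_near m a01; exists m, k.
rewrite /isolates nm km !andTb; apply/allP => j; rewrite mem_iota /= ?add0n ltnS => jm.
rewrite -(ltr_rat R) ratr_norm rmorphB /= ratr_half !ratr_grid.
case: ltP => //= jk; apply/hasP.
have dE : d * 2 = 2^-1 ^+ n.+1 by rewrite /d divfK.
have h := half_exp_gt0 m; have h2 := half_expM m.
have j01 : 0 <= (j%:R * 2^-1 ^+ m : R) <= 1.
  apply/andP; split; first by rewrite mulr_ge0 ?ler0n ?(ltW h).
  by rewrite -[X in _ <= X]h2 ler_pM2r // ler_nat.
have /(Pm _) : [set` `[(0 : R), 1]] (j%:R * 2^-1 ^+ m) by rewrite /= in_itv.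
rewrite /P => /(_ _)/hasP[].
  rewrite -(lerD2r (2^-1 ^+ m)).
  have := ler_distD a (j%:R * 2^-1 ^+ m) (k%:R * 2^-1 ^+ m); rewrite (distrC a).
  by move: jk; lra.
move=> t tm /andP[h3 h4]; exists t => //.
rewrite -2!(ltr_rat R) rmorphD rmorphB /= ratr_half !ratr_grid.
by rewrite h3 h4.
Unshelve. all: by end_near.
Qed.

Definition coef_ready (q : baire) (n z : nat) : bool :=
  (n < hit_time q n)%N || isolates q n (cfst z) (csnd z).

(** If [z] codes the pair of [m] and [j], the constant coefficient is announced as
    [- j / 2^(t + m)], that is [-2^-t] times the isolated grid point; the leading one is [2^-t]. The
    number [0] codes the rational [0]. *)
Definition coef_code (q : baire) (k n z : nat) : nat :=
  let t := hit_time q n in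
  if (n < t)%N then 0%N
  else if k == 0%N then cpair (cpair 0 (csnd z)) (2 ^ (t + cfst z)).-1
  else if k == 1%N then cpair (cpair 1 0) (2 ^ t).-1 else 0%N.

Lemma realq0 : realq R 0 = 0.
Proof.
have -> : 0%N = cpair (cpair 0 0) 0 by [].
by rewrite /realq rat_of_code_cpair subrr mul0r rmorph0.
Qed.

(** The polynomial is found by a case distinction on whether a hit ever occurs, but its name is
    computed without deciding it. Any certificates may be used, one for each position, which suits
    the outcome of an unbounded search. *)
Lemma linear_poly q A : closed_names q A ->
  sval A = [set` `[(0 : R), 1]] \/ (exists a, sval A = [set a]) ->
  (forall n, exists z, coef_ready q n z) /\
  exists f : {poly R},
    (forall r : baire, r 0%N = 1%N ->
      (forall k n, exists2 z, coef_ready q n z &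
        component r k n = coef_code q k n z) -> poly_names r f) /\
    forall x : R, 0 <= x <= 1 ->
      ((exists2 r : R, 0 <= r <= 1 & root f r) -> root f x) -> sval A x.
Proof.
move=> qA A1; have [[nohit ht]|[T hT ht]] := hit_timeP q.
  split=> [n|]; first by exists 0%N; rewrite /coef_ready ht ltnSn.
  exists 0; split=> [r r0 hr|x x01 _].
    split; first by rewrite size_poly0.
    move=> i _ n; have [z _ ->] := hr i n.
    by rewrite /coef_code ht ltnSn realq0 coef0 subr0 normr0 invr_gt0 exprn_gt0.
  apply: contrapT => /(qA _ x01)[t /andP[lx xr]].
  have := nohit t; rewrite /hit -3!(ltr_rat R) rmorph0 rmorph1.
  rewrite -!/(realq R _) (lt_trans lx xr) /=; case/andP: x01 => x0 x1.
  by rewrite (lt_le_trans lx x1) (le_lt_trans x0 xr).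
have [a AE] : exists a, sval A = [set a].
  case: A1 => // AE; exfalso; move: hT; rewrite /hit -3!(ltr_rat R) rmorph0 rmorph1.
  rewrite -!/(realq R _) => /and3P[lr l1 r0].
  (* The midpoint of the overlap of the hitting interval with [0,1] has been removed, so the set is
     not all of [0,1]. *)
  pose l' := Num.max (realq R (cfst (q T))) 0.
  pose r' := Num.min (realq R (csnd (q T))) 1.
  have lr' : l' < r' by rewrite /l' /r' gt_max !lt_min lr l1 r0 ltr01.
  have l'l : realq R (cfst (q T)) <= l' by rewrite le_max lexx.
  have l'0 : 0 <= l' by rewrite le_max lexx orbT.
  have r'r : r' <= realq R (csnd (q T)) by rewrite ge_min lexx.
  have r'1 : r' <= 1 by rewrite ge_min lexx orbT.
  have x01 : 0 <= (l' + r') / 2 <= 1 by apply/andP; split; lra.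
  suff : ~ sval A ((l' + r') / 2) by apply; rewrite AE /= in_itv.
  by apply/(qA _ x01); exists T; apply/andP; split; lra.
have a01 : 0 <= a <= 1.
  by case: A AE {qA A1} => A [cA sA] /= AE; have := sA a; rewrite AE /= in_itv; apply.
split=> [n|].
  have [m [k mk]] := isolates_complete n qA AE.
  by exists (cpair m k); rewrite /coef_ready cfst_pair csnd_pair mk orbT.
exists (2^-1 ^+ T *: ('X - a%:P)); split; last first.
  have fE x : root (2^-1 ^+ T *: ('X - a%:P)) x = (x == a).
    by rewrite rootZ ?expf_neq0 ?invr_eq0 ?pnatr_eq0 // root_XsubC.
  move=> x _; rewrite fE => /(_ _)/eqP->; first by rewrite AE.
  by exists a; rewrite ?fE.
move=> r r0 hr; split.
  by rewrite r0 (leq_trans (size_scale_leq _ _)) // size_XsubC.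
rewrite r0 => i i1 n; have [z zr ->] := hr i n.
have pT m : (2 ^ m).-1.+1 = (2 ^ m)%N by rewrite prednK // expn_gt0.
have hTn := half_exp_gt0 T.
rewrite coefZ coefB coefX coefC -exprVn; move: zr; rewrite /coef_ready /coef_code ht.
have [Tn|nT] := leqP T n.
  rewrite (minn_idPl (leqW Tn)) ltnNge Tn /=.
  case: i i1 => [|[|//]] _ /= => [/(isolates_sound qA AE)|_].
    move=> ka; have -> : realq R (cpair (cpair 0 (csnd z)) (2 ^ (T + cfst z)).-1) =
        - (2^-1 ^+ T * ratr (grid (cfst z) (csnd z))).
      rewrite -(ratr_half T) -rmorphM -rmorphN; congr ratr.
      rewrite rat_of_code_cpair pT sub0r mulNr natrX exprD invfM -!exprVn.
      by rewrite /grid mulrCA.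
    rewrite sub0r mulrN opprK addrC -mulrBr normrM gtr0_norm // distrC.
    rewrite [X in _ < X]exprVn (le_lt_trans _ ka) // ler_piMl ?normr_ge0 //.
    by rewrite exprn_ile1 // ?invr_ge0 // invf_le1 // ler1n.
  rewrite subr0 mulr1 /realq rat_of_code_cpair pT subr0 mul1r fmorphV /= ratr_nat natrX.
  by rewrite -exprVn subrr normr0 half_exp_gt0.
rewrite (minn_idPr nT) ltnSn /= realq0 sub0r normrN normrM gtr0_norm // => _.
(* Here [n < T]: both coefficients have modulus at most [2^-T < 2^-n], so the value [0] is precise
   enough. *)
rewrite (le_lt_trans (y := 2^-1 ^+ T)) //.
  rewrite ler_piMr ?(ltW hTn) //; case: i i1 => [|[|//]] _ /=.
    by case/andP: a01 => a0 a1; rewrite sub0r normrN ger0_norm.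
  by rewrite subr0 normr1.
by rewrite !exprVn ltf_pV2 ?posrE ?exprn_gt0 // ltr_eXn2l ?ltr1n.
Qed.

End Isolation.

Lemma eff_coef_ready {X} {nX : numbered X} (i n z : baire -> X -> nat) :
  eff i -> eff n -> eff z ->
  eff (fun p x => coef_ready (component p (i p x)) (n p x) (z p x)).
Proof.
move=> ei en ez; apply: eff_orb.
  by apply: eff_leq; [apply: eff_succ|apply: eff_hit_time].
by apply: eff_isolates => //; eff.
Qed.

Lemma eff_coef_code {X} {nX : numbered X} (i k n z : baire -> X -> nat) :
  eff i -> eff k -> eff n -> eff z ->
  eff (fun p x => coef_code (component p (i p x)) (k p x) (n p x) (z p x)).
Proof.
move=> ei ek en ez; have et := eff_hit_time ei en.
by rewrite /coef_code; do ![apply: eff_hit_time|eff_all_step].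
Qed.

Lemma Forall2_onth A B (f : A -> B -> Prop) s t : List.Forall2 f s t <->
  size s = size t /\
  forall i x y, onth s i = Some x -> onth t i = Some y -> f x y.
Proof.
split=> [|[]].
  elim=> [|x y s' t' fxy _ [st IH]]; first by split=> // -[].
  split; first by rewrite /= st.
  move=> [|i] x' y' /=; last exact: IH.
  by move=> [<-] [<-].
elim: s t => [|x s IHs] [|y t] st h; [by constructor|by []|by []|].
by constructor; [exact: (h 0%N)|apply: IHs; [case: st|move=> i; exact: (h i.+1)]].
Qed.

Lemma onth_lt A (s : seq A) i x : onth s i = Some x -> (i < size s)%N.
Proof. by move=> E; rewrite -onthTE E. Qed.

Lemma onth_ex A (s : seq A) i : (i < size s)%N -> exists x, onth s i = Some x.
Proof. by rewrite -onthTE; case: onth => // x _; exists x. Qed.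

Lemma onth_mkseq A (F : nat -> A) n i : onth (mkseq F n) i =
  if (i < n)%N then Some (F i) else None.
Proof.
case: ltnP => ni; last first.
  case E : onth => [x|//]; have := onth_lt E.
  by rewrite size_mkseq ltnNge ni.
have [|x E] := @onth_ex _ (mkseq F n) i; first by rewrite size_mkseq.
by rewrite E -(nth_mkseq (F 0%N) F ni) (onth_nth _ _ _ _ E).
Qed.

Lemma component_cpair p i n : p (cpair i n).+1 = component p i n.
Proof. by []. Qed.

Lemma BRoot_total (R : realType) (f : poly_space R) : exists x, BRoot f x.
Proof.
have [[r r01 fr]|nr] := pselect (exists2 r : R, 0 <= r <= 1 & root f r).
  by exists (exist _ r r01).
have h : 0 <= (0 : R) <= 1 by rewrite lexx ler01.
by exists (exist _ 0 h) => /nr.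
Qed.

Lemma star_dom (X Y : repSpace) (f : multifun X Y) (xs : star_space X) :
  (forall i x, onth xs i = Some x -> mdom f x) -> mdom (star f) xs.
Proof.
elim: xs => [|x xs IHxs] h; first by exists [::]; constructor.
have [y fxy] := h 0%N x erefl.
have [i x'|ys fxys] := IHxs _; first exact: (h i.+1).
by exists (y :: ys); constructor.
Qed.

Lemma AoUC_le_BRoot (R : realType) :
  weihrauch_le (star (@AoUC R)) (star (@BRoot R)).
Proof.
(* Position [x > 0] of the new name belongs to component [i x]. Inside a component, position [0] is
   the degree bound [1], and a position [(cpair k n).+1] holds the approximation of coefficient [k]
   at precision [n]. Past the last component the search succeeds at once, which keeps it total. *)
pose i x := cfst x.-1.
pose P p x z := (p 0 <= i x)%N || coef_ready (component p (i x)) (csnd (csnd x.-1).-1)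
  z.
pose f p x z := if x == 0%N then p 0%N else
  if csnd x.-1 == 0%N then 1%N
  else coef_code (component p (i x)) (cfst (csnd x.-1).-1) (csnd (csnd x.-1).-1) z.
have [] := @eff_search P f.
- rewrite /P; apply: eff_orb; first by eff.
  by apply: eff_coef_ready; eff.
- rewrite /f /i; do 2![apply: eff_if; [by eff|by eff|]].
  by apply: eff_coef_code; eff.
move=> K cK hK.
(* The roots obtained are already the required points, so the answer is read off from the odd half
   of the paired name. *)
exists (fun p => Some (fun n => p n.*2.+1)), K; split=> //.
  apply: eff_computable; apply: (eff_ext (f := fun p n => p (2 * n)%N.+1)).
    by move=> p n; rewrite mul2n.
  by eff.
move=> G realG p xs [p0 hp] [ys /Forall2_onth[sxy xys]].
have xi j A : onth xs j = Some A -> sval A = [set` `[(0 : R), 1]] \/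
  (exists a, sval A = [set a]).
  move=> xj; have [|y yj] := @onth_ex _ ys j; first by rewrite -sxy (onth_lt xj).
  by have [] := xys _ _ _ xj yj.
have [x|r Kp hr] := hK p.
  rewrite /P; case: leqP => [_|ip]; first by exists 0%N.
  have [|A xE] := @onth_ex _ xs (i x); first by rewrite -p0.
  have [+ _] := linear_poly (hp _ _ xE) (xi _ _ xE).
  exact.
have /choice[F hF] j : exists g : {poly R}, forall A, onth xs j = Some A ->
    poly_names (component r j) g /\ forall x, BRoot g x -> AoUC A x.
  case xE : (onth xs j) => [A|]; last by exists 0.
  have [_ [g [gn gr]]] := linear_poly (hp _ _ xE) (xi _ _ xE).
  exists g => _ [<-]; split.
    have jp : (j < p 0)%N by rewrite p0 (onth_lt xE).
    apply: gn => [|k n].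
      have [z _] := hr (cpair j 0).+1; rewrite component_cpair => ->.
      by rewrite /f /= csnd_pair.
    have [z] := hr (cpair j (cpair k n).+1).+1; rewrite !component_cpair /P /f /i.
    have e0 m : (m.+1 == 0%N) = false by [].
    rewrite !(succnK, cfst_pair, csnd_pair, e0).
    rewrite leqNgt jp => Pz ->.
    by exists z.
  move=> x gx; split; first exact: xi xE.
  by apply: gr; first exact: (svalP x).
pose zs : star_space (poly_space R) := mkseq F (size xs).
have zsr : star_names r zs.
  split; first by rewrite size_mkseq -p0; have [z _ ->] := hr 0%N.
  move=> j g; rewrite onth_mkseq; case: ltnP => // jx [<-].
  by have [A xE] := onth_ex jx; have [] := hF _ _ xE.
have zdom : mdom (star (@BRoot R)) zs.
  by apply: star_dom => j x _; exact: BRoot_total.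
have [q [ws [Gr qws /Forall2_onth[szw zws]]]] := realG r _ zsr zdom.
rewrite size_mkseq in szw.
exists q, ws; split=> //.
  rewrite Kp /= Gr /=; congr Some; apply/funext => n.
  by rewrite /bpair /= odd_double /= uphalf_double.
apply/Forall2_onth; split=> // j A w xj wj; have [_] := hF _ _ xj; apply.
by apply: zws wj; rewrite onth_mkseq (onth_lt xj).
Qed.

(** * Normalised factorisations *)

Lemma mem_iota0 n i : (i \in iota 0 n) = (i < n)%N.
Proof. by rewrite mem_iota. Qed.

Section System.
Variable F : realFieldType.
Implicit Types (a y : nat -> F) (N i j k l : nat).

(* The sequence [y] encodes the factors [|y_(3i)| X - (y_(3i+1) + y_(3i+2) 'i)]. *)
Definition den y i : F := `|y (3 * i)%N|.
Definition num_re y i : F := y (3 * i).+1.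
Definition num_im y i : F := y (3 * i).+2.
Definition chart y i : F := den y i * num_re y i.

Definition cmul (z w : F * F) : F * F :=
  (z.1 * w.1 - z.2 * w.2, z.1 * w.2 + z.2 * w.1).

(* Real and imaginary part of the product of the first [N] factors at [x]. *)
Definition factors_at y N (x : F) : F * F :=
  nat_rect (fun=> (F * F)%type) (1, 0)
    (fun i z => cmul (den y i * x - num_re y i, - num_im y i) z) N.

Definition poly_at a N (x : F) : F := \sum_(0 <= i < N.+1) a i * x ^+ i.

Definition norm_defect y i : F :=
  `|Num.max (den y i) (num_re y i * num_re y i + num_im y i * num_im y i) - 1|.

Definition order_defect y i : F := Num.max (chart y i - chart y i.+1) 0.

(* Proportionality of two polynomials of degree at most [N] is tested on their
   values at [0, ..., N]. *)
Definition prop_defect a y N k l : F :=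
  `|poly_at a N k%:R * (factors_at y N l%:R).1 - poly_at a N l%:R *
    (factors_at y N k%:R).1| +
  `|poly_at a N k%:R * (factors_at y N l%:R).2 - poly_at a N l%:R *
    (factors_at y N k%:R).2|.

Definition system a y N : F :=
  (\sum_(0 <= i < N) norm_defect y i + \sum_(0 <= i < N.-1) order_defect y i) +
  \sum_(0 <= k < N.+1) \sum_(0 <= l < N.+1) prop_defect a y N k l.

(** A key can be negative, while an instance must be a subset of [0,1]. On the cube [|y k| <= 1] a
    key never exceeds [1]. *)
Definition clamp y i : F := Num.max (chart y i) 0.
Definition resid a y N i : F := `|poly_at a N (clamp y i)|.
Definition resid_prod a y N j : F := \prod_(0 <= i < j) resid a y N i.

Definition cand_defect y j (x : F) : F := `|x - clamp y j|.
Definition choice_defect a y N j (x : F) : F :=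
  `|x * (resid_prod a y N j + resid a y N j) - resid_prod a y N j|.

(** One nonnegative function per instance, with the factorisation [y] as a hidden variable: an index
    [e < N] stands for a candidate, the index [N + j] for the [j]-th choice equation. Gathering all
    conditions in a single number lets one grid test serve both kinds. *)
Definition defect a y N e (x : F) : F :=
  system a y N +
  (if (e < N)%N then cand_defect y e x else choice_defect a y N (e - N) x).

Definition solution a y N : Prop :=
  [/\ forall i, (i < N)%N -> Num.max (den y i)
    (num_re y i * num_re y i + num_im y i * num_im y i) = 1,
      forall i, (i.+1 < N)%N -> chart y i <= chart y i.+1 &
      forall k l, (k <= N)%N -> (l <= N)%N ->
        poly_at a N k%:R * (factors_at y N l%:R).1 = poly_at a N l%:R *
          (factors_at y N k%:R).1 /\
        poly_at a N k%:R * (factors_at y N l%:R).2 = poly_at a N l%:R *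
          (factors_at y N k%:R).2].

Lemma sum_nat_eq0 n (G : nat -> F) : (forall i, 0 <= G i) ->
  (\sum_(0 <= i < n) G i == 0) = all (fun i => G i == 0) (iota 0 n).
Proof.
move=> G0; rewrite psumr_eq0 // /index_iota subn0.
by apply: eq_all => i.
Qed.

Lemma norm_defect_ge0 y i : 0 <= norm_defect y i. Proof. exact: normr_ge0. Qed.
Lemma order_defect_ge0 y i : 0 <= order_defect y i.
Proof. by rewrite le_max lexx orbT. Qed.
Lemma prop_defect_ge0 a y N k l : 0 <= prop_defect a y N k l.
Proof. by rewrite addr_ge0. Qed.

Lemma system_ge0 a y N : 0 <= system a y N.
Proof.
rewrite !addr_ge0 ?sumr_ge0 // => i _; rewrite ?norm_defect_ge0 ?order_defect_ge0 //.
by rewrite sumr_ge0 // => j _; exact: prop_defect_ge0.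
Qed.

Lemma system_eq0P a y N : system a y N = 0 <-> solution a y N.
Proof.
have n0 := norm_defect_ge0 y; have o0 := order_defect_ge0 y.
have p0 k l := prop_defect_ge0 a y N k l.
have pp0 k : 0 <= \sum_(0 <= l < N.+1) prop_defect a y N k l by rewrite sumr_ge0.
have -> : system a y N = 0 <-> [&& all (fun i => norm_defect y i == 0) (iota 0 N),
    all (fun i => order_defect y i == 0) (iota 0 N.-1) &
    all (fun k => all (fun l => prop_defect a y N k l == 0) (iota 0 N.+1))
      (iota 0 N.+1)].
  rewrite -!sum_nat_eq0 //.
  under eq_all => k do rewrite -(sum_nat_eq0 _ (p0 k)).
  rewrite -sum_nat_eq0 // andbA -!paddr_eq0 ?addr_ge0 ?sumr_ge0 //.
  by split=> /eqP.
split=> [/and3P[/allP h1 /allP h2 /allP h3]|[h1 h2 h3]].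
  split=> [i iN|i iN|k l kN lN].
  - have /h1 : i \in iota 0 N by rewrite mem_iota0.
    by rewrite normr_eq0 subr_eq0 => /eqP.
  - have /h2 : i \in iota 0 N.-1 by rewrite mem_iota0; lia.
    move=> /eqP E; have : chart y i - chart y i.+1 <= order_defect y i by rewrite
      le_max lexx.
    by rewrite E subr_le0.
  - have /h3/allP/(_ l) : k \in iota 0 N.+1 by rewrite mem_iota.
    rewrite mem_iota0 ltnS => /(_ lN).
    by rewrite paddr_eq0 // !normr_eq0 !subr_eq0 => /andP[/eqP ? /eqP ?].
apply/and3P; split; apply/allP => i; rewrite mem_iota0 => iN.
- by rewrite normr_eq0 subr_eq0 h1.
- by apply/eqP/max_idPr; rewrite subr_le0 h2 //; lia.
- apply/allP => l; rewrite mem_iota0 => lN.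
  have [E1 E2] := h3 i l iN lN.
  by rewrite paddr_eq0 // !normr_eq0 !subr_eq0 E1 E2 !eqxx.
Qed.

Lemma defect_eq0P a y N e (x : F) : defect a y N e x = 0 <->
  solution a y N /\ if (e < N)%N then x = clamp y e else
    x * (resid_prod a y N (e - N) + resid a y N (e - N)) = resid_prod a y N (e - N).
Proof.
rewrite -system_eq0P /defect /cand_defect /choice_defect; have s0 := system_ge0 a y N.
case: ifP => _; split.
- by move/eqP; rewrite paddr_eq0 // => /andP[/eqP-> /eqP/normr0_eq0/subr0_eq->].
- by move=> [-> ->]; rewrite add0r subrr normr0.
- by move/eqP; rewrite paddr_eq0 // => /andP[/eqP-> /eqP/normr0_eq0/subr0_eq->].
- by move=> [-> xE]; rewrite add0r xE subrr normr0.
Qed.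

End System.

(** * Complex factorisations and uniqueness of the sorted keys *)

Section Factors.
Variable R : realType.
Local Notation C := R[i].
Local Notation toC := (real_complex R).
Implicit Types (f : {poly R}) (y : nat -> R).

Definition num_at y i : C := Complex (num_re y i) (num_im y i).
Definition factor (u : R) (v : C) : {poly C} := toC u *: 'X - v%:P.
Definition bpoly y N : {poly C} := \prod_(0 <= i < N) factor (den y i) (num_at y i).

Lemma factor_horner (u s t x : R) :
  (factor u (Complex s t)).[toC x] = Complex (u * x - s) (- t).
Proof.
rewrite /factor hornerD hornerN hornerZ hornerX hornerC -rmorphM /=.
by apply/eqP; rewrite eq_complex /= sub0r !eqxx.
Qed.

Lemma bpoly_horner y N (x : R) :
  (bpoly y N).[toC x] = Complex (factors_at y N x).1 (factors_at y N x).2.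
Proof.
elim: N => [|N IHN]; first by rewrite /bpoly big_geq // hornerC.
by rewrite /bpoly big_nat_recr //= hornerM IHN factor_horner mulrC.
Qed.

Lemma poly_at_horner f N (x : R) : (size f <= N.+1)%N ->
  poly_at (fun i => f`_i) N x = f.[x].
Proof. by move=> sf; rewrite /poly_at big_mkord (horner_coef_wide _ sf). Qed.

Lemma size_factor u v : (size (factor u v) <= 2)%N.
Proof.
rewrite /factor (leq_trans (size_polyD _ _)) // geq_max.
rewrite (leq_trans (size_scale_leq _ _)) ?size_polyX //= size_polyN.
by rewrite (leq_trans (size_polyC_leq1 _)).
Qed.

Lemma factor_neq0 (u s t : R) : Num.max u (s * s + t * t) = 1 ->
  factor u (Complex s t) != 0.
Proof.
move=> E; apply/negP => /eqP E0.
have := congr1 (fun p : {poly C} => p.[toC 0]) E0.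
have := congr1 (fun p : {poly C} => p.[toC 1]) E0.
rewrite !factor_horner horner0 => -[h1 h2]; rewrite horner0 => -[h3 h4].
have s0 : s = 0 by lra. have t0 : t = 0 by lra.
have u0 : u = 0 by move: h1; rewrite s0 subr0 mulr1.
by move: E; rewrite s0 t0 u0 mulr0 addr0 maxxx => /esym/eqP; rewrite oner_eq0.
Qed.

Lemma size_bpoly y N : (size (bpoly y N) <= N.+1)%N.
Proof.
elim: N => [|N IHN]; first by rewrite /bpoly big_geq // size_poly1.
rewrite /bpoly big_nat_recr //= (leq_trans (size_polyMleq _ _)) //.
have := leq_add IHN (size_factor (den y N) (num_at y N)); rewrite addn2.
by rewrite -/(bpoly y N); case: (_ + _)%N.
Qed.

Definition nodes (S : nzRingType) (N : nat) : seq S := [seq k%:R | k <- iota 0 N.+1].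

Lemma uniq_nodes N : uniq (nodes R N) /\ uniq (nodes C N).
Proof.
split; rewrite map_inj_uniq ?iota_uniq //.
  by move=> i j /eqP; rewrite eqr_nat => /eqP.
by move=> i j /eqP; rewrite eqr_nat => /eqP.
Qed.

(** A nonzero [f] of degree at most [N] is nonzero at some node [l] among [0, ..., N]. With [b] the
    product of the factors, [f(l) b - b(l) f] has degree at most [N] and vanishes at all [N + 1]
    nodes. The ratio is nonzero because normalised factors are. *)
Lemma bpoly_proportional f y N : f != 0 -> (size f <= N.+1)%N ->
  solution (fun i => f`_i) y N ->
  exists2 m : C, m != 0 & bpoly y N = m *: map_poly toC f.
Proof.
move=> f0 sf [nrm _ prp].
have b0 : bpoly y N != 0.
  rewrite /bpoly prodf_seq_neq0; apply/allP => i.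
  by rewrite mem_index_iota /= => iN; apply/factor_neq0/nrm.
have [l lN fl] : exists2 l, (l <= N)%N & f.[l%:R] != 0.
  apply: contrapT => no; move/negP: f0; apply; apply/eqP.
  apply: (@roots_geq_poly_eq0 _ _ (nodes R N)).
  - apply/allP => _ /mapP[l +] ->; rewrite mem_iota0 ltnS => lN.
    by apply/negPn/negP => fl; apply: no; exists l.
  - by case: (uniq_nodes N).
  - by rewrite size_map size_iota.
have toCn (k : nat) : toC k%:R = k%:R by rewrite rmorph_nat.
have fC k : (map_poly toC f).[k%:R] = toC f.[k%:R] by rewrite -toCn horner_map.
have E : toC f.[l%:R] *: bpoly y N - (bpoly y N).[l%:R] *: map_poly toC f = 0.
  apply: (@roots_geq_poly_eq0 _ _ (nodes C N)).
  - apply/allP => _ /mapP[k +] ->; rewrite mem_iota0 ltnS => kN.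
    apply/eqP; rewrite !hornerE /= fC -!toCn !bpoly_horner.
    have [E1 E2] := prp k l kN lN; rewrite !poly_at_horner // in E1 E2.
    apply/eqP; rewrite subr_eq0 eq_complex /= !mul0r !mulr0 !subr0 !addr0 add0r.
    by rewrite -E1 -E2 ![_ * f.[_]]mulrC !eqxx.
  - by case: (uniq_nodes N).
  - rewrite size_map size_iota (leq_trans (size_polyD _ _)) // geq_max size_polyN.
    rewrite !(leq_trans (size_scale_leq _ _)) ?size_bpoly //.
    by rewrite size_map_poly.
have flC : toC f.[l%:R] != 0 by rewrite fmorph_eq0.
have bE : bpoly y N = ((bpoly y N).[l%:R] / toC f.[l%:R]) *: map_poly toC f.
  by apply: (scalerI flC); rewrite scalerA mulrCA divff // mulr1; exact/subr0_eq.
exists ((bpoly y N).[l%:R] / toC f.[l%:R]) => //.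
by apply: contraNneq b0 => m0; rewrite bE m0 scale0r.
Qed.

(** Some factor vanishes at [z], so [Im v = 0] and [Re v = u z]. If [u < 1], both terms of the
    normalising maximum would be below [1], as [0 <= z <= 1]; thus [u = 1] and the key is [z]. *)
Lemma root_chart f y N (z : R) : f != 0 -> (size f <= N.+1)%N ->
  (forall k, `|y k| <= 1) -> solution (fun i => f`_i) y N ->
  0 <= z <= 1 -> root f z -> exists2 i, (i < N)%N & chart y i = z.
Proof.
move=> f0 sf y1 sol /andP[z0 z1] /eqP fz.
have [m m0 bE] := bpoly_proportional f0 sf sol.
have : (bpoly y N).[toC z] == 0 by rewrite bE hornerZ horner_map fz rmorph0 mulr0.
rewrite /bpoly horner_prod prodf_seq_eq0 /index_iota subn0 => bz.
have /hasP [j] : has (fun i => (factor (den y i) (num_at y i)).[toC z] == 0) (iota 0 N).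
  by apply: sub_has bz => i.
rewrite mem_iota0 factor_horner => iN /eqP[us tz].
exists j => //; case: sol => /(_ _ iN) + _ _.
have t0 : num_im y j = 0 by apply/eqP; rewrite -oppr_eq0 tz.
have u0 : 0 <= den y j by exact: normr_ge0.
have u1 : den y j <= 1 by exact: y1.
have sE : num_re y j = den y j * z by apply/esym/subr0_eq.
rewrite /chart sE t0 mulr0 addr0; set u := den y j in u0 u1 *.
have [-> _|u1'] := eqVneq u 1; first by rewrite !mul1r.
have u1'' : u < 1 by rewrite lt_neqAle u1' u1.
have uz1 : u * z < 1 by rewrite (le_lt_trans _ u1'') // ler_piMr.
have uz0 : 0 <= u * z by rewrite mulr_ge0.
move=> E; exfalso; have : Num.max u (u * z * (u * z)) < 1.
  by rewrite gt_max u1'' /= (le_lt_trans _ uz1) // ler_piMr // ltW.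
by rewrite E ltxx.
Qed.

(* The sorting key [u * Re v] of the normalised factor with root [z]. *)
Definition projective_root (z : C) : R :=
  complex.Re z / Num.max 1 (complex.Re z * complex.Re z + complex.Im z * complex.Im z).

Definition finite_roots y N : seq C :=
  [seq Complex (num_re y i / den y i) (num_im y i / den y i) | i <- iota 0 N & den y i
    != 0].

Lemma factor_finite (u s t : R) : u != 0 ->
  factor u (Complex s t) = toC u *: ('X - (Complex (s / u) (t / u))%:P).
Proof.
move=> u0; rewrite /factor scalerBr; congr (_ - _).
rewrite -mul_polyC -polyCM; congr polyC.
apply/eqP; rewrite eq_complex /= !mul0r subr0 addr0.
by rewrite !(mulrC u) !divfK // !eqxx.
Qed.

(** Factors with [u = 0] are constants and go into [c], together with the leading coefficients of
    the others. *)
Lemma bpoly_split y N : exists c : C,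
  bpoly y N = c *: \prod_(z <- finite_roots y N) ('X - z%:P).
Proof.
rewrite /finite_roots big_map big_filter /bpoly /index_iota subn0.
elim: (iota 0 N) => [|i s [c IHs]]; first by exists 1; rewrite !big_nil scale1r.
rewrite !big_cons IHs; case: eqP => [u0|/eqP u0] /=.
  exists (- num_at y i * c); rewrite /factor u0 rmorph0 scale0r sub0r.
  by rewrite -scalerA -(mul_polyC (- num_at y i)) polyCN.
exists (toC (den y i) * c); rewrite factor_finite //.
by rewrite -scalerAl -scalerAr scalerA.
Qed.

(** If [u = 1], the root is [v] and [|v| <= 1]. Otherwise [|v| = 1], so [u = 1 / |z|] and
    [u * Re v = Re z / |z|^2]. *)
Lemma chart_projective y i :
  Num.max (den y i) (num_re y i * num_re y i + num_im y i * num_im y i) = 1 ->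
    den y i <= 1 ->
  den y i != 0 ->
  chart y i = projective_root (Complex (num_re y i / den y i) (num_im y i / den y i)).
Proof.
rewrite /projective_root /chart /=; set u := den y i; set s := num_re y i;
  set t := num_im y i.
move=> mx u1 u0; have {u0} u0 : 0 < u by rewrite lt_def u0 normr_ge0.
set n := s / u * (s / u) + _.
have nE : s * s + t * t = u * u * n by rewrite /n; field; rewrite gt_eqF.
have [uE|un1] := eqVneq u 1.
  by rewrite nE uE !mul1r in mx; rewrite mx uE !divr1 mul1r.
have u1' : u < 1 by rewrite lt_neqAle un1 u1.
have uun : u * u * n = 1.
  by move: mx; rewrite nE; case: leP => // _ uE; move: u1'; rewrite uE ltxx.
have n0 : 0 < n by rewrite -(pmulr_rgt0 _ (mulr_gt0 u0 u0)) uun.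
have n1 : 1 <= n.
  rewrite -uun ler_piMl ?(ltW n0) //.
  by rewrite mulr_ile1 // ltW.
rewrite (max_idPr n1); have -> : n = (u * u)^-1.
  by apply: (mulfI (lt0r_neq0 (mulr_gt0 u0 u0))); rewrite uun divff ?gt_eqF ?mulr_gt0.
by field; rewrite gt_eqF.
Qed.

(** Each factor at infinity has key [0] whatever its phase, so the multiset of keys is determined by
    the finite roots and [N]. *)
Lemma chart_roots y N : (forall k, `|y k| <= 1) ->
  (forall i, (i < N)%N ->
    Num.max (den y i) (num_re y i * num_re y i + num_im y i * num_im y i) = 1) ->
  perm_eq [seq chart y i | i <- iota 0 N]
    ([seq projective_root z | z <- finite_roots y N] ++
     nseq (N - size (finite_roots y N)) 0).
Proof.
move=> y1 nrm.
rewrite (perm_trans (y := [seq chart y i | i <- [seq i <- iota 0 N | den y i != 0] ++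
    [seq i <- iota 0 N | ~~ (den y i != 0)]])) //.
  by apply: perm_map; rewrite perm_sym perm_filterC.
have E1 : [seq chart y i | i <- [seq i <- iota 0 N | den y i != 0]] =
    [seq projective_root z | z <- finite_roots y N].
  rewrite /finite_roots -map_comp; apply/eq_in_map => i.
  rewrite mem_filter mem_iota0 => /andP[u0 iN] /=.
  by apply: chart_projective => //; [exact: nrm|exact: y1].
have E2 : [seq chart y i | i <- [seq i <- iota 0 N | ~~ (den y i != 0)]] =
    nseq (N - size (finite_roots y N)) 0.
  have -> : (N - size (finite_roots y N))%N =
      size [seq i <- iota 0 N | ~~ (den y i != 0)].
    rewrite size_map -[X in (X - _)%N](size_iota 0 N).
    by rewrite -(count_predC (fun i => den y i != 0)) !size_filter addKn.
  elim: (iota 0 N) => //= i s IHs; case: eqP => //= u0.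
  by rewrite IHs /chart u0 mul0r.
by rewrite map_cat E1 E2.
Qed.

(** Both products are multiples of the same nonzero [f], so their finite roots agree up to order.
    The lists of keys are then permutations of each other, and both are sorted. *)
Lemma chart_unique f y y' N : f != 0 -> (size f <= N.+1)%N ->
  (forall k, `|y k| <= 1) -> (forall k, `|y' k| <= 1) ->
  solution (fun i => f`_i) y N -> solution (fun i => f`_i) y' N ->
  forall i, (i < N)%N -> chart y i = chart y' i.
Proof.
move=> f0 sf y1 y1' sol sol'.
have [m m0 bE] := bpoly_proportional f0 sf sol.
have [m' m0' bE'] := bpoly_proportional f0 sf sol'.
have [c cE] := bpoly_split y N; have [c' cE'] := bpoly_split y' N.
have fC0 : map_poly toC f != 0 by rewrite map_poly_eq0.
have monE (g : {poly C}) (p q : {poly C}) (d e : C) : g != 0 -> p \is monic ->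
    q \is monic -> d *: p = g -> e *: q = g -> p = q.
  move=> g0 /monicP p1 /monicP q1 pg qg.
  have dE : d = lead_coef g by rewrite -pg lead_coefZ p1 mulr1.
  have eE : e = lead_coef g by rewrite -qg lead_coefZ q1 mulr1.
  by apply: (@scalerI _ _ (lead_coef g)); rewrite ?lead_coef_eq0 // -{1}dE -eE pg qg.
have /prod_XsubC_eq zz : \prod_(z <- finite_roots y N) ('X - z%:P) =
    \prod_(z <- finite_roots y' N) ('X - z%:P).
  apply: (monE (map_poly toC f) _ _ (m^-1 * c) (m'^-1 * c')) => //;
    rewrite ?monic_prod_XsubC //.
    by rewrite -scalerA -cE bE scalerA mulVf // scale1r.
  by rewrite -scalerA -cE' bE' scalerA mulVf // scale1r.
have srt x : solution (fun i => f`_i) x N ->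
    sorted <=%O [seq chart x i | i <- iota 0 N].
  move=> [_ ord _]; apply/(sortedP 0) => i; rewrite size_map size_iota => iN.
  rewrite !(nth_map 0%N) ?size_iota ?nth_iota ?add0n ?(ltnW iN) //.
  exact: ord.
have E : [seq chart y i | i <- iota 0 N] = [seq chart y' i | i <- iota 0 N].
  apply: le_sorted_eq; [exact: srt|exact: srt|].
  case: sol sol' => [h _ _] [h' _ _].
  rewrite (perm_trans (chart_roots y1 h)) // perm_sym
    (perm_trans (chart_roots y1' h')) //.
  by rewrite perm_sym (perm_size zz) perm_cat2r perm_map.
move=> i iN; have := congr1 (fun s => nth 0 s i) E.
by rewrite !(nth_map 0%N) ?size_iota ?nth_iota.
Qed.

Definition weight (w : R * R * R) : R := w.1.1 * w.1.2.

Definition normalised (w : R * R * R) : bool :=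
  (0 <= w.1.1) && (Num.max w.1.1 (w.1.2 * w.1.2 + w.2 * w.2) == 1).

Definition factor_of (w : R * R * R) : {poly C} :=
  factor w.1.1 (Complex w.1.2 w.2).

Definition flatten3 (T : seq (R * R * R)) (k : nat) : R :=
  let w := nth (1, 0, 0) T (k %/ 3) in
  if (k %% 3 == 0)%N then w.1.1 else if (k %% 3 == 1)%N then w.1.2 else w.2.

Lemma flatten3E T i : [/\ flatten3 T (3 * i) = (nth (1, 0, 0) T i).1.1,
  flatten3 T (3 * i).+1 = (nth (1, 0, 0) T i).1.2 &
  flatten3 T (3 * i).+2 = (nth (1, 0, 0) T i).2].
Proof.
have E c : (c < 3)%N -> flatten3 T (3 * i + c) =
    let w := nth (1, 0, 0) T i in
    if (c == 0)%N then w.1.1 else if (c == 1)%N then w.1.2 else w.2.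
  move=> c3; rewrite /flatten3 mulnC divnMDl // modnMDl divn_small //.
  by rewrite modn_small // addn0.
by have := E 0%N isT; have := E 1%N isT; have := E 2%N isT; rewrite addn0 addn1 addn2.
Qed.

(** Sorting the triples by their key does not change the product, so only normalisation and
    proportionality have to be supplied. *)
Lemma solution_of_seq f N (T : seq (R * R * R)) : (size f <= N.+1)%N ->
  size T = N -> all normalised T ->
  (forall k l : C, (map_poly toC f).[k] * (\prod_(w <- T) factor_of w).[l] =
    (map_poly toC f).[l] * (\prod_(w <- T) factor_of w).[k]) ->
  exists y, [/\ forall k, `|y k| <= 1, solution (fun i => f`_i) y N &
    perm_eq [seq chart y i | i <- iota 0 N] [seq weight w | w <- T]].
Proof.
move=> sf sT nT prp.
pose T' := sort (relpre weight <=%O) T.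
have TT' : perm_eq T' T by rewrite perm_sort.
have sT' : size T' = N by rewrite (perm_size TT').
have nT' : all normalised T' by rewrite (perm_all _ TT').
pose w0 : R * R * R := (1, 0, 0).
(* The default triple is normalised too, so the bound on [y] also holds at the positions from
   [3 * N] on. *)
have nw i : normalised (nth w0 T' i).
  have [iN|Ni] := ltnP i (size T'); first by move/all_nthP: nT'; exact.
  by rewrite nth_default // /normalised /= mulr0 addr0 ler01 (max_idPl _) ?ler01 ?eqxx.
pose y := flatten3 T'.
have yE i := flatten3E T' i; rewrite -/y -/w0 in yE.
have cuE i : den y i = (nth w0 T' i).1.1.
  have [E _ _] := yE i; rewrite /den E ger0_norm //.
  by case/andP: (nw i).
have csE i : num_re y i = (nth w0 T' i).1.2 by have [] := yE i.
have ctE i : num_im y i = (nth w0 T' i).2 by have [] := yE i.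
have bE : bpoly y N = \prod_(w <- T) factor_of w.
  rewrite -(perm_big _ TT') /= (big_nth w0) sT' /bpoly.
  by apply: eq_bigr => i _; rewrite /factor_of /num_at cuE csE ctE.
have kE : [seq chart y i | i <- iota 0 N] = [seq weight w | w <- T'].
  apply: (@eq_from_nth _ 0); rewrite ?size_map ?size_iota // => i iN.
  by rewrite !(nth_map 0%N) ?(nth_map w0) ?size_iota ?sT' ?nth_iota // /chart cuE csE.
exists y; split; last by rewrite kE perm_map.
- move=> k; rewrite /y /flatten3; have /andP[u0 /eqP mx] := nw (k %/ 3)%N.
  have u1 : (nth w0 T' (k %/ 3)).1.1 <= 1 by rewrite -mx le_max lexx.
  have st1 : (nth w0 T' (k %/ 3)).1.2 * (nth w0 T' (k %/ 3)).1.2 +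
    (nth w0 T' (k %/ 3)).2 * (nth w0 T' (k %/ 3)).2 <= 1 by rewrite -mx le_max lexx
      orbT.
  have sq1 (p q : R) : p * p + q * q <= 1 -> `|p| <= 1.
    move=> pq; rewrite -(@ler_pXn2r _ 2) ?nnegrE // expr1n real_normK ?num_real //
      expr2.
    by rewrite (le_trans _ pq) // lerDl -expr2 sqr_ge0.
  case: ifP => _; first by rewrite ger0_norm.
  by case: ifP => _; [exact: sq1 st1|apply: sq1; rewrite addrC; exact: st1].
- split=> [i iN|i iN|k l _ _].
  + by rewrite cuE csE ctE; case/andP: (nw i) => _ /eqP.
  + have : sorted <=%O [seq chart y i | i <- iota 0 N].
      by rewrite kE sorted_map sort_sorted // => u v; exact: le_total.
    move=> /(sortedP 0)/(_ i); rewrite size_map size_iota => /(_ iN).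
    by rewrite !(nth_map 0%N) ?size_iota ?nth_iota ?add0n ?(ltnW iN).
  + have := prp (toC k%:R) (toC l%:R).
    rewrite !horner_map /= -bE !bpoly_horner !poly_at_horner //.
    move=> /eqP; rewrite eq_complex /= !mul0r !subr0 !addr0.
    by move=> /andP[/eqP-> /eqP->].
Qed.

(** This is [X - z] divided by [max (1, |z|)]. *)
Definition triple_of (z : C) : R * R * R :=
  let n := complex.Re z * complex.Re z + complex.Im z * complex.Im z in
  if n <= 1 then (1, complex.Re z, complex.Im z) else
  let u := (Num.sqrt n)^-1 in (u, u * complex.Re z, u * complex.Im z).

Lemma triple_ofP (z : C) : normalised (triple_of z) /\
  exists2 u : R, u != 0 & factor_of (triple_of z) = toC u *: ('X - z%:P).
Proof.
case: z => p q; rewrite /triple_of /=; set n := p * p + q * q.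
have [n1|n1] := leP n 1.
  split; first by rewrite /normalised /= ler01 (max_idPl _) ?eqxx.
  exists 1; first exact: oner_neq0.
  by rewrite /factor_of /= factor_finite ?oner_neq0 // !divr1.
have r0 : 0 < Num.sqrt n by rewrite sqrtr_gt0 (lt_trans ltr01).
have r2 : Num.sqrt n * Num.sqrt n = n by rewrite -expr2 sqr_sqrtr // ltW //
  (lt_trans ltr01).
have r1 : 1 < Num.sqrt n.
  by rewrite ltNge; apply/negP => r1; move: n1; rewrite -r2 ltNge mulr_ile1 // ltW.
split.
  rewrite /normalised /= invr_ge0 ltW //=; set r := Num.sqrt n in r0 r1 r2 *.
  have -> : r^-1 * p * (r^-1 * p) + r^-1 * q * (r^-1 * q) = 1.
    have -> : r^-1 * p * (r^-1 * p) + r^-1 * q * (r^-1 * q) = n / (r * r).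
      by rewrite /n; field; rewrite gt_eqF.
    by rewrite r2 divff // gt_eqF // (lt_trans ltr01).
  by rewrite (max_idPr _) // invf_le1 // ltW.
exists (Num.sqrt n)^-1; first by rewrite invr_eq0 gt_eqF.
rewrite /factor_of /= factor_finite ?invr_eq0 ?gt_eqF //.
by rewrite !invrK ![_ * Num.sqrt n]mulrC !mulrA divff ?gt_eqF // !mul1r.
Qed.

Lemma solution_exists f N : (size f <= N.+1)%N ->
  exists2 y, forall k, `|y k| <= 1 & solution (fun i => f`_i) y N.
Proof.
move=> sf; have [rs rsE] := closed_field_poly_normal (map_poly toC f).
have nor0 : normalised (0, 1, 0).
  by rewrite /normalised /= lexx mul1r mulr0 addr0 (max_idPr _) ?ler01 ?eqxx.
have [f0|f0] := eqVneq f 0.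
  have [//||||y [y1 sol _]] := @solution_of_seq f N (nseq N (0, 1, 0)).
  - by rewrite size_nseq.
  - by rewrite all_nseq nor0 orbT.
  - by move=> k l; rewrite f0 rmorph0 !horner0 !mul0r.
  by exists y.
have srs : (size rs <= N)%N.
  move: sf; rewrite -(size_map_poly toC) rsE size_scale ?lead_coef_eq0 ?map_poly_eq0 //.
  by rewrite size_prod_XsubC.
(* The gap between the degree of [f] and [N] is filled with roots at infinity: the triple
   [(0, 1, 0)] is the constant factor [-1]. *)
pose T := [seq triple_of z | z <- rs] ++ nseq (N - size rs) (0, 1, 0).
have [c cE] : exists c : C, \prod_(w <- T) factor_of w = c *: map_poly toC f.
  have [c cE] : exists c : C,
      \prod_(w <- map triple_of rs) factor_of w = c *: \prod_(z <- rs) ('X - z%:P).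
    elim: (rs) => [|z s [c cE]]; first by exists 1; rewrite !big_nil scale1r.
    have [_ [u _ uE]] := triple_ofP z; exists (toC u * c).
    by rewrite /= !big_cons cE uE -scalerAl -scalerAr scalerA.
  have nE m : \prod_(w <- nseq m (0, 1, 0)) factor_of w = ((-1) ^+ m)%:P :> {poly C}.
    elim: m => [|m IHm] /=; first by rewrite big_nil expr0.
    rewrite big_cons IHm /factor_of /factor /= rmorph0 scale0r sub0r exprS polyCM
      -polyCN.
    by congr (_%:P * _); apply/eqP; rewrite eq_complex /= oppr0 !eqxx.
  exists ((-1) ^+ (N - size rs) * c / lead_coef (map_poly toC f)).
  rewrite /T big_cat /= nE cE [LHS]mulrC mul_polyC scalerA.
  by rewrite {2}rsE scalerA divfK ?lead_coef_eq0 ?map_poly_eq0.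
have [//||||y [y1 sol _]] := @solution_of_seq f N T; last by exists y.
- by rewrite size_cat size_map size_nseq subnKC.
- rewrite all_cat all_nseq nor0 orbT andbT all_map; apply/allP => z _ /=.
  by have [] := triple_ofP z.
- by move=> k l; rewrite cE !hornerZ mulrCA [RHS]mulrCA [X in _ * X]mulrC.
Qed.

(** Proportionality to the zero polynomial is void, so [N] copies of [X - x] form a solution. *)
Lemma zero_solution N (x : R) : 0 <= x <= 1 ->
  exists y, [/\ forall k, `|y k| <= 1, solution (fun i => (0 : {poly R})`_i) y N &
    forall i, (i < N)%N -> chart y i = x].
Proof.
move=> /andP[x0 x1].
have [||||y [y1 sol kE]] := @solution_of_seq 0 N (nseq N (1, x, 0)).
- by rewrite size_poly0.
- by rewrite size_nseq.
- rewrite all_nseq /normalised /= ler01 mulr0 addr0 (max_idPl _) ?eqxx ?orbT //.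
  by rewrite mulr_ile1.
- by move=> k l; rewrite rmorph0 !horner0 !mul0r.
exists y; split=> // i iN; apply/eqP.
have := perm_mem kE (chart y i); rewrite map_f ?mem_iota0 // => /esym.
by rewrite map_nseq /weight /= mul1r mem_nseq => /andP[].
Qed.

End Factors.

(** * Lipschitz bounds and separation *)

Section Ratr.
Variable R : realType.
Implicit Types (a y : nat -> rat) (x : rat).
Local Notation ratR := (ratr : rat -> R).

Lemma ratr_chart y i : chart (ratR \o y) i = ratr (chart y i).
Proof. by rewrite /chart /den /num_re /= rmorphM /= ratr_norm. Qed.

Lemma ratr_poly_at a N x : poly_at (ratR \o a) N (ratr x) = ratr (poly_at a N x).
Proof.
by rewrite /poly_at rmorph_sum; apply: eq_bigr => i _; rewrite rmorphM rmorphXn.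
Qed.

Lemma ratr_factors_at y N x : factors_at (ratR \o y) N (ratr x) =
  (ratr (factors_at y N x).1, ratr (factors_at y N x).2).
Proof.
elim: N => [|N IHN]; first by rewrite /= rmorph1 rmorph0.
rewrite /= IHN /cmul /den /num_re /num_im /=.
by rewrite !(rmorphM, rmorphB, rmorphN, rmorphD, ratr_norm) /=
  ?(rmorphM, rmorphB, rmorphN, rmorphD, ratr_norm).
Qed.

Lemma ratr_clamp y i : clamp (ratR \o y) i = ratr (clamp y i).
Proof. by rewrite /clamp ratr_chart maxr_rat rmorph0. Qed.

Lemma ratr_resid a y N i : resid (ratR \o a) (ratR \o y) N i = ratr (resid a y N i).
Proof. by rewrite /resid ratr_clamp ratr_poly_at ratr_norm. Qed.

Lemma ratr_resid_prod a y N j : resid_prod (ratR \o a) (ratR \o y) N j = ratr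
    (resid_prod a y N j).
Proof. by rewrite /resid_prod rmorph_prod; apply: eq_bigr => i _; rewrite ratr_resid.
Qed.

Lemma ratr_prop_defect a y N k l :
  prop_defect (ratR \o a) (ratR \o y) N k l = ratr (prop_defect a y N k l).
Proof.
have E (p b q c : rat) : `|ratR p * ratr b - ratr q * ratr c| = ratr `|p * b - q * c|.
  by rewrite ratr_norm rmorphB /= !rmorphM.
by rewrite /prop_defect -!(ratr_nat R) !ratr_poly_at !ratr_factors_at /= !E rmorphD.
Qed.

Lemma ratr_system a y N : system (ratR \o a) (ratR \o y) N = ratr (system a y N).
Proof.
rewrite /system !rmorphD !rmorph_sum /=; congr (_ + _ + _).
- apply: eq_bigr => i _; rewrite /norm_defect /den /num_re /num_im /=.
  by rewrite ratr_norm rmorphB /= maxr_rat rmorph1 rmorphD /= !rmorphM /= ratr_norm.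
- by apply: eq_bigr => i _; rewrite /order_defect !ratr_chart maxr_rat rmorphB rmorph0.
- apply: eq_bigr => k _; rewrite rmorph_sum; apply: eq_bigr => l _.
  exact: ratr_prop_defect.
Qed.

Lemma ratr_defect a y N e x :
  defect (ratR \o a) (ratR \o y) N e (ratr x) = ratr (defect a y N e x).
Proof.
rewrite /defect rmorphD /= ratr_system; congr (_ + _); case: ifP => _.
  by rewrite /cand_defect ratr_clamp ratr_norm rmorphB.
by rewrite /choice_defect ratr_resid_prod ratr_resid [RHS]ratr_norm rmorphB /= rmorphM
  /= rmorphD.
Qed.

End Ratr.

(** Simultaneous bounds and Lipschitz constants when the coefficients are bounded by [B]: [pvK] for
    polynomial values at arguments up to [N + 2], which covers the nodes [0, ..., N] and the
    candidates; [bvK] for products of factors; [ppK] for products of residuals; [lipK] for the whole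
    defect. In [lipK], [6 = 1 + (2 + 2) + 1], [4 = 2 + 2] and [3 = 1 + 2] come from the rules for
    sums and maxima, and [8] from four products at cost [2 * K * L]. *)
Definition pvK N B : nat := (N.+1 * (2 * B * (2 * N.+2) ^ N))%N.
Definition bvK N : nat := ((4 * (2 * N.+2).+1) ^ N)%N.
Definition ppK N B : nat := ((2 * pvK N B) ^ N)%N.
Definition lipK N B : nat :=
  (N * 6 + N * 4 + N.+1 * (N.+1 * (8 * pvK N B * bvK N)) +
   (3 + (2 * (ppK N B + pvK N B) + ppK N B)))%N.

Section Near.
Variables (R : realType) (d : R).
Hypothesis d0 : 0 <= d.
Implicit Types (x y : R) (K L : nat).

(* Boundedness by [K] is carried along so that Lipschitz constants multiply. *)
Definition near_by K x x' : Prop :=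
  [/\ `|x| <= K%:R, `|x'| <= K%:R & `|x - x'| <= K%:R * d].

Lemma near_by_le K L x x' : (K <= L)%N -> near_by K x x' -> near_by L x x'.
Proof.
rewrite -(ler_nat R) => KL [h1 h2 h3]; split; [exact: le_trans KL|exact: le_trans KL|].
by rewrite (le_trans h3) // ler_wpM2r.
Qed.

Lemma near_by_refl K x : `|x| <= K%:R -> near_by K x x.
Proof. by move=> h; split=> //; rewrite subrr normr0 mulr_ge0. Qed.

Lemma near_by_add K L x x' y y' :
  near_by K x x' -> near_by L y y' -> near_by (K + L) (x + y) (x' + y').
Proof.
move=> [x1 x2 x3] [y1 y2 y3]; split; rewrite natrD.
- by rewrite (le_trans (ler_normD _ _)) // lerD.
- by rewrite (le_trans (ler_normD _ _)) // lerD.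
- by rewrite opprD addrACA mulrDl (le_trans (ler_normD _ _)) // lerD.
Qed.

Lemma near_by_opp K x x' : near_by K x x' -> near_by K (- x) (- x').
Proof. by move=> [x1 x2 x3]; split; rewrite ?normrN // -opprD normrN. Qed.

Lemma near_by_sub K L x x' y y' :
  near_by K x x' -> near_by L y y' -> near_by (K + L) (x - y) (x' - y').
Proof. by move=> xx' /near_by_opp; exact: near_by_add. Qed.

Lemma near_by_mul K L x x' y y' :
  near_by K x x' -> near_by L y y' -> near_by (2 * K * L) (x * y) (x' * y').
Proof.
move=> [x1 x2 x3] [y1 y2 y3].
have K0 : 0 <= K%:R :> R by []. have L0 : 0 <= L%:R :> R by [].
have KL : (K%:R * L%:R : R) <= (2 * K * L)%:R.
  by rewrite -natrM ler_nat -mulnA leq_pmull.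
split.
- by rewrite (le_trans _ KL) // normrM ler_pM.
- by rewrite (le_trans _ KL) // normrM ler_pM.
- have -> : x * y - x' * y' = (x - x') * y + x' * (y - y') by ring.
  rewrite (le_trans (ler_normD _ _)) // !normrM !natrM.
  have -> : 2%:R * K%:R * L%:R * d = (K%:R * d) * L%:R + K%:R * (L%:R * d) by ring.
  by rewrite lerD // ler_pM.
Qed.

Lemma near_by_norm K x x' : near_by K x x' -> near_by K `|x| `|x'|.
Proof.
move=> [x1 x2 x3]; split; rewrite ?normr_id //.
by rewrite (le_trans (ler_dist_dist _ _)).
Qed.

Lemma near_by_max K L x x' y y' :
  near_by K x x' -> near_by L y y' -> near_by (K + L) (Num.max x y) (Num.max x' y').
Proof.
move=> [x1 x2 x3] [y1 y2 y3].
have K0 : 0 <= K%:R :> R by []. have L0 : 0 <= L%:R :> R by [].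
have Kd : 0 <= K%:R * d by rewrite mulr_ge0.
have Ld : 0 <= L%:R * d by rewrite mulr_ge0.
rewrite /near_by natrD mulrDl; move: x1 x2 x3 y1 y2 y3; rewrite !ler_norml.
move=> /andP[? ?] /andP[? ?] /andP[? ?] /andP[? ?] /andP[? ?] /andP[? ?].
by split; apply/andP; split; case: (leP x y) => ?; case: (leP x' y') => ?; lra.
Qed.

Lemma near_by_sum n K (F G : nat -> R) :
  (forall i, (i < n)%N -> near_by K (F i) (G i)) ->
  near_by (n * K) (\sum_(0 <= i < n) F i) (\sum_(0 <= i < n) G i).
Proof.
elim: n => [|n IHn] h; first by rewrite !big_geq //; apply: near_by_refl;
  rewrite normr0.
rewrite !big_nat_recr //= mulSn addnC; apply: near_by_add; last exact: h.
by apply: IHn => i iN; apply: h; rewrite ltnW.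
Qed.

Lemma near_by_prod n K (F G : nat -> R) :
  (forall i, (i < n)%N -> near_by K (F i) (G i)) ->
  near_by ((2 * K) ^ n) (\prod_(0 <= i < n) F i) (\prod_(0 <= i < n) G i).
Proof.
elim: n => [|n IHn] h; first by rewrite !big_geq //; apply: near_by_refl;
  rewrite normr1.
rewrite !big_nat_recr //= (_ : (2 * K) ^ n.+1 = 2 * (2 * K) ^ n * K)%N;
  last by rewrite expnS; ring.
apply: near_by_mul; last exact: h.
by apply: IHn => i iN; apply: h; rewrite ltnW.
Qed.

Lemma near_by_exp n K x x' : near_by K x x' -> near_by ((2 * K) ^ n) (x ^+ n) (x' ^+ n).
Proof.
move=> xx'; have := @near_by_prod n K (fun=> x) (fun=> x') (fun _ _ => xx').
by rewrite !prodr_const_nat subn0.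
Qed.

Variables (N B : nat) (a a' y y' : nat -> R).
Hypothesis B0 : (0 < B)%N.
Hypothesis aa' : forall i, (i <= N)%N -> near_by B (a i) (a' i).
Hypothesis yy' : forall k, (k < 3 * N)%N -> near_by 1 (y k) (y' k).

Lemma near_by_den i : (i < N)%N -> near_by 1 (den y i) (den y' i).
Proof. by move=> iN; apply/near_by_norm/yy'; lia. Qed.

Lemma near_by_num_re i : (i < N)%N -> near_by 1 (num_re y i) (num_re y' i).
Proof. by move=> iN; apply/yy'; lia. Qed.

Lemma near_by_num_im i : (i < N)%N -> near_by 1 (num_im y i) (num_im y' i).
Proof. by move=> iN; apply/yy'; lia. Qed.

Lemma near_by_chart i : (i < N)%N -> near_by 2 (chart y i) (chart y' i).
Proof. by move=> iN; exact: (near_by_mul (near_by_den iN) (near_by_num_re iN)). Qed.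

Lemma near_by_clamp i : (i < N)%N -> near_by 2 (clamp y i) (clamp y' i).
Proof.
move=> iN; rewrite -[2%N]addn0; apply: near_by_max; first exact: near_by_chart.
by apply: near_by_refl; rewrite normr0.
Qed.

Lemma near_by_poly_at x x' : near_by N.+2 x x' ->
  near_by (pvK N B) (poly_at a N x) (poly_at a' N x').
Proof.
move=> xx'; apply: near_by_sum => i; rewrite ltnS => iN.
apply: near_by_mul; first exact: aa'.
apply: (@near_by_le ((2 * N.+2) ^ i)); last exact: near_by_exp.
by rewrite leq_pexp2l.
Qed.

Lemma near_by_factors_at x : `|x| <= N.+2%:R ->
  near_by (bvK N) (factors_at y N x).1 (factors_at y' N x).1 /\
  near_by (bvK N) (factors_at y N x).2 (factors_at y' N x).2.
Proof.
move=> xN; rewrite /bvK; set L := (4 * _)%N.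
suff h n : (n <= N)%N -> near_by (L ^ n) (factors_at y n x).1 (factors_at y' n x).1 /\
  near_by (L ^ n) (factors_at y n x).2 (factors_at y' n x).2 by exact: h.
elim: n => [_|n IHn nN].
  by split; apply: near_by_refl; rewrite /= ?normr1 ?normr0.
have [h1 h2] := IHn (ltnW nN).
have fx : near_by (2 * N.+2).+1 (den y n * x - num_re y n) (den y' n * x - num_re y' n).
  rewrite -addn1 -[(2 * N.+2)%N]/((2 * 1 * N.+2)%N); apply: near_by_sub;
    last exact: near_by_num_re.
  by apply: near_by_mul; [exact: near_by_den|exact: near_by_refl].
have ft : near_by (2 * N.+2).+1 (- num_im y n) (- num_im y' n).
  by apply: (@near_by_le 1) => //; apply/near_by_opp/near_by_num_im.
(* Each part of a complex product combines two real products, at cost [2 * K * L] each; hence the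
   [4] in [bvK]. *)
have E : (L ^ n.+1 = 2 * (2 * N.+2).+1 * L ^ n + 2 * (2 * N.+2).+1 * L ^ n)%N.
  by rewrite expnS {1}/L; ring.
rewrite E; split; rewrite /= /cmul /=.
- by apply: near_by_sub; apply: near_by_mul.
- by apply: near_by_add; apply: near_by_mul.
Qed.

Lemma near_by_system : near_by
  (N * 6 + N * 4 + N.+1 * (N.+1 * (8 * pvK N B * bvK N)))
  (system a y N) (system a' y' N).
Proof.
have one : near_by 1 1 1 by apply: near_by_refl; rewrite normr1.
apply: near_by_add; first apply: near_by_add.
- apply: near_by_sum => i iN; apply: near_by_norm.
  apply: (near_by_sub (K := 5)) one; apply: (near_by_max (K := 1));
    first exact: near_by_den.
  apply: (near_by_add (K := 2) (L := 2)).
    exact: (near_by_mul (near_by_num_re iN) (near_by_num_re iN)).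
  exact: (near_by_mul (near_by_num_im iN) (near_by_num_im iN)).
- apply: (@near_by_le (N.-1 * 4)); first by rewrite leq_mul2r leq_pred orbT.
  apply: near_by_sum => i iN; apply: (near_by_max (K := 4) (L := 0)).
    by apply: (near_by_sub (K := 2)); apply: near_by_chart; lia.
  by apply: near_by_refl; rewrite normr0.
- apply: near_by_sum => k kN; apply: near_by_sum => l lN.
  have natN m : (m < N.+1)%N -> `|m%:R| <= N.+2%:R :> R.
    by move=> mN; rewrite normr_nat ler_nat ltnW // ltnW.
  have pk m : (m < N.+1)%N -> near_by (pvK N B) (poly_at a N m%:R) (poly_at a' N m%:R).
    by move=> mN; apply/near_by_poly_at/near_by_refl/natN.
  have [b1 b2] := near_by_factors_at (natN _ kN);
    have [b3 b4] := near_by_factors_at (natN _ lN).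
  have -> : (8 * pvK N B * bvK N = (2 * pvK N B * bvK N + 2 * pvK N B * bvK N) +
    (2 * pvK N B * bvK N + 2 * pvK N B * bvK N))%N by ring.
  by apply: near_by_add; apply: near_by_norm; apply: near_by_sub; apply: near_by_mul;
    rewrite ?b1 //; exact: pk.
Qed.

Lemma near_by_resid i : (i < N)%N -> near_by (pvK N B) (resid a y N i)
    (resid a' y' N i).
Proof.
move=> iN; apply/near_by_norm/near_by_poly_at/(@near_by_le 2) => //.
exact: near_by_clamp.
Qed.

Lemma near_by_resid_prod j : (j < N)%N -> near_by (ppK N B) (resid_prod a y N j)
    (resid_prod a' y' N j).
Proof.
move=> jN; apply: (@near_by_le ((2 * pvK N B) ^ j)).
  have p0 : (0 < pvK N B)%N by rewrite /pvK !muln_gt0 /= B0 expn_gt0.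
  by apply: leq_pexp2l (ltnW jN); rewrite muln_gt0 p0.
by apply: near_by_prod => i ij; apply: near_by_resid; exact: ltn_trans jN.
Qed.

Lemma near_by_defect e x x' : (e < 2 * N)%N -> near_by 1 x x' ->
  near_by (lipK N B) (defect a y N e x) (defect a' y' N e x').
Proof.
move=> eN xx'; apply: near_by_add; first exact: near_by_system.
case: ltnP => Ne.
  apply: (@near_by_le 3); first by rewrite leq_addr.
  by apply/near_by_norm/(near_by_sub (K := 1)) => //; exact: near_by_clamp.
have jN : (e - N < N)%N by lia.
apply: near_by_le (leq_addl _ _) _; apply/near_by_norm/near_by_sub;
  last exact: near_by_resid_prod.
rewrite -[2%N]muln1; apply: near_by_mul => //.
by apply: near_by_add; [exact: near_by_resid_prod|exact: near_by_resid].
Qed.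

End Near.

(** * Grids on the cube and separation of the defect from zero *)

Lemma digits b M (dg : nat -> nat) : (forall k, dg k < b)%N ->
  exists2 g, (g < b ^ M)%N & forall k, (k < M)%N -> ((g %/ b ^ k) %% b = dg k)%N.
Proof.
elim: M dg => [|M IHM] dg hd; first by exists 0%N.
have [g gM gd] := IHM (fun k => dg k.+1) (fun k => hd k.+1).
have b0 : (0 < b)%N by apply: leq_ltn_trans (hd 0%N).
exists (g * b + dg 0)%N.
  rewrite expnSr (@leq_trans (g.+1 * b)%N) ?leq_mul2r ?gM ?orbT //.
  by rewrite mulSn addnC ltn_add2r hd.
move=> [_|k kM]; first by rewrite expn0 divn1 modnMDl modn_small.
by rewrite expnS divnMA divnMDl // (divn_small (hd 0%N)) addn0 gd.
Qed.

(** The number of points of mesh [2^-s] in [-1,1]. A grid vector is coded by one number [g], whose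
    digits in this base are the coordinates, so bounded quantification over [g] runs through the
    whole grid. *)
Definition gridbase (s : nat) : nat := (2 ^ s.+1).+1.
Definition gridvec (s g k : nat) : rat :=
  ((g %/ gridbase s ^ k) %% gridbase s)%:R * 2^-1 ^+ s - 1.

Section Separation.
Variable R : realType.
Implicit Types (a y : nat -> R).

Lemma ratr_gridvec s g k : ratr (gridvec s g k) =
  ((g %/ gridbase s ^ k) %% gridbase s)%:R * 2^-1 ^+ s - 1 :> R.
Proof. by rewrite /gridvec rmorphB rmorphM /= ratr_half ratr_nat rmorph1. Qed.

Lemma gridvec_le1 s g k : `|ratr (gridvec s g k) : R| <= 1.
Proof.
rewrite ratr_gridvec; set m := (_ %% _)%N.
have h := half_exp_gt0 R s; have hM := half_expM R s.
have : (m%:R : R) <= (2 ^ s.+1)%:R by rewrite ler_nat -ltnS ltn_mod.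
rewrite expnS natrM -(ler_pM2r h) -mulrA hM mulr1 => m2.
have m0 : 0 <= m%:R * 2^-1 ^+ s :> R by rewrite mulr_ge0 // ltW.
by rewrite ler_norml; apply/andP; split; lra.
Qed.

Lemma gridvec_near s M y : (forall k, `|y k| <= 1) ->
  exists2 g, (g < gridbase s ^ M)%N &
    forall k, (k < M)%N -> `|ratr (gridvec s g k) - y k| <= 2^-1 ^+ s.
Proof.
move=> y1.
have /choice[dg hd] k : exists j, (j < gridbase s)%N /\
    `|(j%:R * 2^-1 ^+ s - 1) - y k| <= 2^-1 ^+ s.
  have y01 : 0 <= (y k + 1) / 2 <= 1.
    by move: (y1 k); rewrite ler_norml => /andP[? ?]; apply/andP; split; lra.
  have [j jb] := grid_near s.+1 y01; rewrite exprS.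
  set h := 2^-1 ^+ s; move=> jy; exists j; split; first by rewrite ltnS.
  by apply: ltW; move: jy; rewrite !ltr_norml => /andP[? ?]; apply/andP; split; lra.
have [g gM gd] := digits M (fun k => (hd k).1).
by exists g => // k kM; rewrite ratr_gridvec gd //; exact: (hd k).2.
Qed.

Lemma defect_ge0 a y N e (x : R) : 0 <= defect a y N e x.
Proof.
by rewrite addr_ge0 ?system_ge0 //; case: ifP => _; exact: normr_ge0.
Qed.

(** Compactness of the cube makes pointwise positivity uniform. In the factor [2], one Lipschitz
    error pays for rounding the data and the other is the threshold of the grid test. *)
Lemma defect_separated a N B e (x : R) : (0 < B)%N -> (e < 2 * N)%N ->
  (forall i, (i <= N)%N -> `|a i| <= B%:R) -> 0 <= x <= 1 ->
  (forall y, (forall k, `|y k| <= 1) -> defect a y N e x != 0) ->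
  exists s, forall y, (forall k, `|y k| <= 1) ->
    2 * (lipK N B)%:R * 2^-1 ^+ s < defect a y N e x.
Proof.
move=> B0 eN aB /andP[x0 x1] nz; set L : R := (lipK N B)%:R.
have L0 : 0 <= L by [].
have x1' : `|x| <= 1 by rewrite ger0_norm.
pose M := (3 * N)%N.
(* The defect reads only the first [3 * N] entries, so the cube of that dimension carries the
   compactness argument and the extension by [0] changes nothing. *)
pose ext (v : 'rV[R]_M) (k : nat) : R := oapp (fun i => v ord0 i) 0 (insub k).
have extE v (i : 'I_M) : ext v i = v ord0 i by rewrite /ext valK.
pose K := [set v : 'rV[R]_M | forall i, `[(-1 : R), 1]%classic (v ord0 i)].
have extK v : K v -> forall k, `|ext v k| <= 1.
  move=> Kv k; rewrite /ext; case: insubP => [i _ _|_] /=; last by rewrite normr0.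
  by have := Kv i; rewrite /= in_itv /= ler_norml.
have nearE (d : R) y y' : 0 <= d -> (forall k, `|y k| <= 1) ->
  (forall k, `|y' k| <= 1) ->
    (forall k, (k < M)%N -> `|y k - y' k| <= d) ->
    `|defect a y N e x - defect a y' N e x| <= L * d.
  move=> d0 y1 y1' yy; have [|||_ _] := @near_by_defect R d d0 N B a a y y' B0 _ _ e x
    x eN.
  - by move=> i iN; apply: near_by_refl => //; exact: aB.
  - by move=> k kM; split=> //; rewrite mul1r yy.
  - exact: near_by_refl.
  exact.
pose P s v := K v -> 2 * L * 2^-1 ^+ s < defect a (ext v) N e x.
have cov : \forall s \near \oo, K `<=` P s.
  have /compact_near_coveringP := @rV_compact R M (fun=> `[(-1 : R), 1]%classic)
    (fun=> @segment_compact R (-1) 1).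
  apply=> v Kv; pose r := defect a (ext v) N e x.
  have r0 : 0 < r by rewrite lt_def defect_ge0 nz //; exact: extK.
  (* Moving [v] by less than [d] costs at most [L d], and [2 L 2^-s <= 2 L d] is required; together
     [3 L d < r]. The summand [1] keeps the divisor positive. *)
  pose d := r / (4 * (L + 1)).
  have L1 : 0 < 4 * (L + 1) by rewrite mulr_gt0 // ltr_wpDl.
  have d0 : 0 < d by rewrite divr_gt0.
  have Ld : L * d + d = r / 4 by rewrite /d; field; rewrite gt_eqF // ltr_wpDl.
  near=> v' s => /= Kv'.
  have vv' : ball v d v' by near: v'; apply: nbhsx_ballx.
  have sd : 2^-1 ^+ s < d by near: s; exact: small_half.
  have : `|defect a (ext v) N e x - defect a (ext v') N e x| <= L * d.
    apply: nearE; [exact: ltW|exact: extK|exact: extK|move=> k kM].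
    have vv k' : ball (v ord0 k') d (v' ord0 k') by case: vv' => _; exact.
    by have := vv (Ordinal kM); rewrite /ball /= -!extE => /ltW.
  rewrite -/r ler_norml => /andP[_ h].
  have : L * 2^-1 ^+ s <= L * d by rewrite ler_wpM2l // ltW.
  rewrite -mulrA; move: (L * 2^-1 ^+ s) (L * d) Ld h => p q Ld h pq; lra.
have [s _ /(_ s (leqnn s)) Ps] := cov; exists s => y y1.
pose v : 'rV[R]_M := \row_(i < M) y i.
have Kv : K v by move=> i; rewrite /= in_itv /= mxE -ler_norml.
have : `|defect a y N e x - defect a (ext v) N e x| <= L * 0.
  apply: nearE => // [|k kM]; first exact: extK.
  by rewrite -[k]/(val (Ordinal kM)) extE mxE subrr normr0.
by rewrite mulr0 normr_le0 subr_eq0 => /eqP->; exact: Ps.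
Unshelve. all: by end_near.
Qed.

(** * The instances of AoUC attached to a polynomial, and the selection of a root *)

Section Instances.
Variables (f : {poly R}) (N : nat).
Hypothesis sf : (size f <= N.+1)%N.
Local Notation coefs := (fun i => f`_i).

Definition inst_set (e : nat) : set R :=
  [set x | 0 <= x <= 1 /\
    exists y, (forall k, `|y k| <= 1) /\ defect coefs y N e x = 0].

Lemma resid_unique y y' i : (forall k, `|y k| <= 1) -> (forall k, `|y' k| <= 1) ->
  solution coefs y N -> solution coefs y' N -> (i < N)%N ->
  resid coefs y N i = resid coefs y' N i.
Proof.
move=> y1 y1' sol sol' iN; rewrite /resid !poly_at_horner //.
have [->|f0] := eqVneq f 0; first by rewrite !horner0.
by rewrite /clamp (chart_unique f0 sf y1 y1' sol sol' iN).
Qed.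

Lemma resid_prod_unique y y' j : (forall k, `|y k| <= 1) -> (forall k, `|y' k| <= 1) ->
  solution coefs y N -> solution coefs y' N -> (j < N)%N ->
  resid_prod coefs y N j = resid_prod coefs y' N j.
Proof.
move=> y1 y1' sol sol' jN; apply: eq_big_nat => i /andP[_ ij].
by apply: resid_unique => //; exact: ltn_trans jN.
Qed.

Lemma resid_ge0 a y i : 0 <= resid a y N i. Proof. exact: normr_ge0. Qed.

Lemma resid_prod_ge0 a y j : 0 <= resid_prod a y N j.
Proof. by apply: prodr_ge0 => i _; exact: resid_ge0. Qed.

(** A candidate is unique for [f <> 0] and arbitrary in [0,1] for [f = 0]. A choice equation depends
    on the factorisation only through [P] and [m], which are unique in both cases: it is void if
    [P + m = 0] and has the single solution [P / (P + m)] otherwise. *)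
Lemma inst_setP e : (e < 2 * N)%N ->
  inst_set e = [set` `[(0 : R), 1]] \/ exists a : R, inst_set e = [set a].
Proof.
move=> eN; have [y0 y01 sol0] := solution_exists sf.
have full : (forall x : R, 0 <= x <= 1 -> exists y, (forall k, `|y k| <= 1) /\
    defect coefs y N e x = 0) -> inst_set e = [set` `[(0 : R), 1]].
  move=> h; apply/seteqP; split=> x /=; rewrite in_itv /=; first by case.
  by move=> x01; split=> //; exact: h.
have [lt_eN|Ne] := ltnP e N.
  have [f0|f0] := eqVneq f 0.
    left; apply: full => x x01; have [y [y1 sol kE]] := zero_solution N x01.
    exists y; split=> //; apply/defect_eq0P; split; first by rewrite f0.
    by rewrite lt_eN /clamp kE // (max_idPl _) //; case/andP: x01.
  right; exists (clamp y0 e); apply/seteqP; split=> x /=.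
    move=> [_ [y [y1 /defect_eq0P[sol]]]]; rewrite lt_eN => ->.
    by rewrite /clamp (chart_unique f0 sf y1 y01 sol sol0 lt_eN).
  move=> ->; split; last first.
    by exists y0; split=> //; apply/defect_eq0P; rewrite lt_eN.
  rewrite /clamp le_max lexx orbT /= ge_max ler01 andbT.
  have u1 : `|den y0 e| <= 1 by rewrite /den normr_id.
  by rewrite (le_trans (ler_norm _)) // normrM mulr_ile1 // y01.
have jN : (e - N < N)%N by lia.
have eN' : (e < N)%N = false by rewrite ltnNge Ne.
set j := (e - N)%N in jN *.
pose P := resid_prod coefs y0 N j; pose m := resid coefs y0 N j.
have P0 : 0 <= P by exact: resid_prod_ge0.
have m0 : 0 <= m by exact: resid_ge0.
have [Pm0|Pm0] := eqVneq (P + m) 0.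
  left; apply: full => x _; exists y0; split=> //; apply/defect_eq0P; split=> //.
  rewrite eN' -/j -/P -/m Pm0 mulr0.
  by move/eqP: Pm0; rewrite paddr_eq0 // => /andP[/eqP].
right; exists (P / (P + m)); apply/seteqP; split=> x /=.
  move=> [_ [y [y1 /defect_eq0P[sol]]]]; rewrite eN' -/j.
  rewrite (resid_prod_unique y1 y01 sol sol0 jN) (resid_unique y1 y01 sol sol0 jN) -/P
    -/m.
  by move=> xE; apply: (mulIf Pm0); rewrite xE divfK.
have Pm : 0 < P + m by rewrite lt_def Pm0 addr_ge0.
move=> ->; split.
  by rewrite divr_ge0 ?addr_ge0 //= ler_pdivrMr // mul1r lerDl.
by exists y0; split=> //; apply/defect_eq0P; split=> //; rewrite eN' -/j -/P -/m divfK.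
Qed.

Definition last_true (b : nat -> bool) (n : nat) : nat :=
  nat_rect (fun=> nat) 0%N (fun j r => if b j then j else r) n.

Lemma last_true_lt b n : (0 < n)%N -> (last_true b n < n)%N.
Proof.
case: n => // n _; elim: n => [|n IHn]; first by rewrite /last_true /=; case: ifP.
rewrite [last_true b _]/=; case: ifP => // _; exact: ltnW.
Qed.

(** By induction on [n]: if the product of the first [n] residuals is [0], the last index below [n]
    with its bit set has residual [0]. When the product of the first [n + 1] vanishes, a set bit at
    [n] forces the residual at [n] to be [0], and an unset bit passes the zero down to the product
    of the first [n]. The full product vanishes because the root [z] is among the candidates. *)
Lemma root_last_true (b : nat -> bool) (c t : nat -> R) (z : R) :
  f != 0 -> 0 <= z <= 1 -> root f z ->
  (forall j, (j < N)%N -> inst_set j (c j)) ->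
  (forall j, (j < N)%N -> inst_set (N + j) (t j)) ->
  (forall j, (j < N)%N -> if b j then 0 < t j else t j < 1) ->
  root f (c (last_true b N)).
Proof.
move=> f0 z01 fz hc ht hb; have [y0 y01 sol0] := solution_exists sf.
have cE j : (j < N)%N -> `|f.[c j]| = resid coefs y0 N j.
  move=> jN; have [_ [y [y1 /defect_eq0P[sol]]]] := hc j jN; rewrite jN => ->.
  by rewrite (resid_unique y01 y1 sol0 sol jN) /resid poly_at_horner.
have tE j : (j < N)%N -> t j * (resid_prod coefs y0 N j + resid coefs y0 N j) =
  resid_prod coefs y0 N j.
  move=> jN; have [_ [y [y1 /defect_eq0P[sol]]]] := ht j jN.
  rewrite ltnNge leq_addr /= addKn.
  by rewrite (resid_prod_unique y01 y1 sol0 sol jN) (resid_unique y01 y1 sol0 sol jN).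
have [i iN kz] := root_chart f0 sf y01 sol0 z01 fz.
have PS n : resid_prod coefs y0 N n.+1 = resid_prod coefs y0 N n * resid coefs y0 N n.
  by rewrite /resid_prod big_nat_recr.
have N0 : (0 < N)%N by apply: leq_ltn_trans iN.
have PN : resid_prod coefs y0 N N = 0.
  apply/eqP; rewrite /resid_prod prodf_seq_eq0; apply/hasP; exists i.
    by rewrite mem_index_iota.
  rewrite /= /resid poly_at_horner // /clamp kz (max_idPl _) ?(eqP fz) ?normr0 //.
  by case/andP: z01.
suff h n : (n <= N)%N -> resid_prod coefs y0 N n = 0 ->
  resid coefs y0 N (last_true b n) = 0.
  by rewrite /root -normr_eq0 cE ?last_true_lt // h.
elim: n => [_|n IHn nN].
  by rewrite /resid_prod big_geq // => /eqP; rewrite oner_eq0.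
have tn := tE _ nN; have bn := hb _ nN.
rewrite PS => /eqP; rewrite mulf_eq0 => Pm; rewrite [last_true b _]/=.
case: (b n) bn => bn.
  case/orP: Pm => /eqP // P0; move/eqP: tn; rewrite P0 add0r mulf_eq0 =>
    /orP[] /eqP // t0.
  by move: bn; rewrite t0 ltxx.
apply: IHn; first exact: ltnW.
case/orP: Pm => /eqP // m0; move/eqP: tn; rewrite m0 addr0.
rewrite -subr_eq0 -{2}[resid_prod _ _ _ _]mul1r -mulrBl mulf_eq0 =>
  /orP[] /eqP // /subr0_eq t1.
by move: bn; rewrite t1 ltxx.
Qed.

End Instances.
End Separation.

(** * From BRoot to AoUC *)

Section EffDefect.
Context {X : Type} {nX : numbered X}.
Variables (a y : baire -> X -> nat -> rat) (N : baire -> X -> nat).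
Hypothesis ea : eff (fun p (z : X * nat) => a p z.1 z.2).
Hypothesis ey : eff (fun p (z : X * nat) => y p z.1 z.2).
Hypothesis eN : eff N.

Lemma eff_seq {Y} {nY : numbered Y} (u : baire -> X -> nat -> rat)
    (x : baire -> Y -> X) (k : baire -> Y -> nat) :
  eff (fun p (z : X * nat) => u p z.1 z.2) -> eff x -> eff k ->
  eff (fun p z => u p (x p z) (k p z)).
Proof. by move=> eu ex ek; apply: (eff_call2 (op := u)). Qed.

Lemma eff_chart {Y} {nY : numbered Y} (x : baire -> Y -> X) (i : baire -> Y -> nat) :
  eff x -> eff i -> eff (fun p z => chart (y p (x p z)) (i p z)).
Proof.
move=> ex ei; rewrite /chart /den /num_re.
by apply: eff_mulr; [apply: eff_normr|]; apply: eff_seq => //; eff.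
Qed.

Lemma eff_poly_at {Y} {nY : numbered Y} (x : baire -> Y -> X) (n : baire -> Y -> nat)
    (t : baire -> Y -> rat) :
  eff x -> eff n -> eff t -> eff (fun p z => poly_at (a p (x p z)) (n p z) (t p z)).
Proof.
move=> ex en et; apply: (eff_sumr (h := fun p z => (n p z).+1)); first by eff.
apply: eff_mulr; first by apply: eff_seq => //; eff; apply: eff_call1 ex _; eff.
by apply: eff_exprn; last eff; apply: eff_call1 et _; eff.
Qed.

Lemma eff_factors_at {Y} {nY : numbered Y} (x : baire -> Y -> X) (n : baire -> Y -> nat)
    (t : baire -> Y -> rat) :
  eff x -> eff n -> eff t -> eff (fun p z => factors_at (y p (x p z)) (n p z) (t p z)).
Proof.
move=> ex en et; rewrite /factors_at.
apply: (eff_nat_rect (T := (rat * rat)%type)) => //; first by eff.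
have ex' : eff (fun p (z : Y * (nat * (rat * rat))) => x p z.1).
  by apply: eff_call1 ex _; eff.
have et' : eff (fun p (z : Y * (nat * (rat * rat))) => t p z.1).
  by apply: eff_call1 et _; eff.
have eu : eff (fun p (z : Y * (nat * (rat * rat))) => den (y p (x p z.1)) z.2.1).
  by apply: eff_normr; apply: eff_seq => //; eff.
have es : eff (fun p (z : Y * (nat * (rat * rat))) => num_re (y p (x p z.1)) z.2.1).
  by apply: eff_seq => //; eff.
have ec : eff (fun p (z : Y * (nat * (rat * rat))) => num_im (y p (x p z.1)) z.2.1).
  by apply: eff_seq => //; eff.
by apply: eff_pair; eff.
Qed.

Lemma eff_clamp {Y} {nY : numbered Y} (x : baire -> Y -> X) (i : baire -> Y -> nat) :
  eff x -> eff i -> eff (fun p z => clamp (y p (x p z)) (i p z)).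
Proof. by move=> ex ei; apply: eff_maxr; [exact: eff_chart|eff]. Qed.

Lemma eff_resid {Y} {nY : numbered Y} (x : baire -> Y -> X) (n i : baire -> Y -> nat) :
  eff x -> eff n -> eff i ->
  eff (fun p z => resid (a p (x p z)) (y p (x p z)) (n p z) (i p z)).
Proof.
by move=> ex en ei; apply: eff_normr; apply: eff_poly_at => //; exact: eff_clamp.
Qed.

Lemma eff_system : eff (fun p x => system (a p x) (y p x) (N p x)).
Proof.
have e1 : eff (fun p (z : X * nat) => z.1) by eff.
have e2 : eff (fun p (z : X * nat) => z.2) by eff.
have N1 : eff (fun p (z : X * nat) => N p z.1) by apply: eff_call1 eN _.
apply: eff_addr; first apply: eff_addr.
- apply: eff_sumr => //; rewrite /norm_defect /den /num_re /num_im.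
  have eys (k : baire -> X * nat -> nat) : eff k -> eff (fun p z => y p z.1 (k p z)).
    by move=> ek; apply: eff_seq.
  apply: eff_normr; apply: eff_addr; last by eff.
  by apply: eff_maxr; do ![apply: eff_normr|apply: eff_addr|apply: eff_mulr];
    apply: eys; eff.
- apply: eff_sumr; first by eff.
  by apply: eff_maxr; last eff; apply: eff_addr; last apply: eff_oppr;
    apply: eff_chart => //; eff.
- apply: (eff_sumr (h := fun p x => (N p x).+1)); first by eff.
  apply: (eff_sumr (h := fun p z => (N p z.1).+1)); first by eff.
  have N2 : eff (fun p (z : X * nat * nat) => N p z.1.1) by apply: eff_call1 eN _; eff.
  have x2 : eff (fun p (z : X * nat * nat) => z.1.1) by eff.
  have pv (k : baire -> X * nat * nat -> nat) : eff k ->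
      eff (fun p z => poly_at (a p z.1.1) (N p z.1.1) (k p z)%:R).
    by move=> ek; apply: eff_poly_at => //; exact: eff_natr.
  have bv (k : baire -> X * nat * nat -> nat) : eff k ->
      eff (fun p z => factors_at (y p z.1.1) (N p z.1.1) (k p z)%:R).
    by move=> ek; apply: eff_factors_at => //; exact: eff_natr.
  have k1 : eff (fun p (z : X * nat * nat) => z.1.2) by eff.
  have k2 : eff (fun p (z : X * nat * nat) => z.2) by eff.
  have := pv _ k1; have := pv _ k2; have := bv _ k1; have := bv _ k2.
  move=> h1 h2 h3 h4; apply: eff_addr; apply: eff_normr; apply: eff_addr;
    try apply: eff_oppr; apply: eff_mulr => //; by [exact: eff_fst|exact: eff_snd].
Qed.

Lemma eff_defect (e : baire -> X -> nat) (t : baire -> X -> rat) :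
  eff e -> eff t -> eff (fun p x => defect (a p x) (y p x) (N p x) (e p x) (t p x)).
Proof.
move=> ee et; apply: eff_addr; first exact: eff_system.
have ei : eff (fun _ (x : X) => x) by exact: eff_id.
apply: eff_if; first by eff.
  by apply: eff_normr; apply: eff_addr => //; apply: eff_oppr; exact: (eff_clamp ei).
have ej : eff (fun p x => e p x - N p x)%N by eff.
have epp : eff (fun p x => resid_prod (a p x) (y p x) (N p x) (e p x - N p x)).
  apply: (eff_prodr (h := fun p x => (e p x - N p x)%N)) => //.
  by apply: eff_resid; [eff|apply: eff_call1 eN _; eff|eff].
have epa := eff_resid ei eN ej.
by apply: eff_normr; apply: eff_addr;
  [apply: eff_mulr => //; apply: eff_addr|apply: eff_oppr].
Qed.

End EffDefect.

(** [N] is shared by a whole tuple and may exceed the degree bound [q 0] announced for one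
    polynomial; past that bound the name carries no information and the coefficient is [0]. *)
Definition pcode (q : baire) (s k : nat) : nat :=
  if (k <= q 0)%N then component q k s else 0%N.

Definition pcoef (q : baire) (s k : nat) : rat := rat_of_code (pcode q s k).

Definition code_size (c : nat) : nat := (cfst (cfst c) + csnd (cfst c))%N.

(** The modulus of [(i - j) / (k + 1)] is at most [i + j]. The approximations at precision [2^0]
    bound the coefficients up to [1], hence every other approximation up to [2]; this is the summand
    [2]. *)
Definition pbound (q : baire) (N : nat) : nat :=
  (2 + \sum_(0 <= k < N.+1) code_size (pcode q 0 k))%N.

Lemma pbound_gt0 q N : (0 < pbound q N)%N.
Proof. by rewrite /pbound add2n. Qed.

Definition code_below (s c : nat) : nat :=
  cpair (cpair (cfst (cfst c) * 2 ^ s) (csnd (cfst c) * 2 ^ s + (csnd c).+1))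
    ((csnd c).+1 * 2 ^ s).-1.

Definition code_above (s c : nat) : nat :=
  cpair (cpair (cfst (cfst c) * 2 ^ s + (csnd c).+1) (csnd (cfst c) * 2 ^ s))
    ((csnd c).+1 * 2 ^ s).-1.

(** If the defect exceeds the rounding error at every grid vector, it is nonzero for the true
    coefficients, for every [y] in the cube and every [x] of [0,1] within [2^-s] of [c]. That
    neighbourhood may therefore be removed. *)
Definition excluded (q : baire) (N e s c : nat) : bool :=
  (0 <= rat_of_code c) && ((rat_of_code c <= 1) &&
  all (fun g => (lipK N (pbound q N))%:R * 2^-1 ^+ s <
                defect (pcoef q s) (gridvec s g) N e (rat_of_code c))
    (iota 0 (gridbase s ^ (3 * N)))).

Definition enum_compl (q : baire) (N e n : nat) : nat :=
  if excluded q N e (cfst n) (csnd n)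
  then cpair (code_below (cfst n) (csnd n)) (code_above (cfst n) (csnd n))
  (* An interval with equal ends: nothing is removed. *)
  else cpair 0 0.

Section EffEnum.
Context {X : Type} {nX : numbered X}.
Variables (i N : baire -> X -> nat).
Hypotheses (ei : eff i) (eN : eff N).

Lemma eff_pcode {Y} {nY : numbered Y} (x : baire -> Y -> X) (s k : baire -> Y -> nat) :
  eff x -> eff s -> eff k ->
  eff (fun p z => pcode (component p (i p (x p z))) (s p z) (k p z)).
Proof.
move=> ex es ek; have eix : eff (fun p z => i p (x p z)) by exact: (eff_call1 ei ex).
apply: eff_if; last by eff.
  by apply: eff_leq => //; apply: (eff_component eix); exact: eff_nat.
by apply: (eff_component eix); eff.
Qed.

Lemma eff_lipK (B : baire -> X -> nat) : eff B -> eff (fun p x => lipK (N p x) (B p x)).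
Proof. by move=> eB; rewrite /lipK /ppK /bvK /pvK; eff. Qed.

Lemma eff_pbound : eff (fun p x => pbound (component p (i p x)) (N p x)).
Proof.
apply: eff_addn; first exact: eff_nat.
apply: (eff_sumn (h := fun p x => (N p x).+1)); first by eff.
have ec : eff (fun p (z : X * nat) => pcode (component p (i p z.1)) 0 z.2).
  by apply: eff_pcode; eff.
by rewrite /code_size; apply: eff_addn;
  [apply/eff_cfst/eff_cfst|apply/eff_csnd/eff_cfst].
Qed.

Lemma eff_excluded (e s c : baire -> X -> nat) : eff e -> eff s -> eff c ->
  eff (fun p x => excluded (component p (i p x)) (N p x) (e p x) (s p x) (c p x)).
Proof.
move=> ee es ec; apply: eff_andb; first by eff.
apply: eff_andb; first by eff.
apply: (eff_all (h := fun p x => (gridbase (s p x) ^ (3 * N p x))%N)).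
  by rewrite /gridbase; eff.
have lift (f : baire -> X -> nat) : eff f -> eff (fun p (z : X * nat) => f p z.1).
  by move=> ef; apply: (eff_call1 ef); eff.
have eK := lift _ (eff_lipK eff_pbound); have ec' := lift _ ec.
have es' := lift _ es; have ee' := lift _ ee; have eN' := lift _ eN.
apply: eff_ltr; first by apply: eff_mulr; [exact: eff_natr|eff].
apply: (eff_defect (a := fun p z => pcoef (component p (i p z.1)) (s p z.1))
  (y := fun p z => gridvec (s p z.1) z.2)) => //; last by eff.
- apply: eff_rat_of_code; apply: eff_pcode; [by eff| |by eff].
  by apply: (eff_call1 es); eff.
- have es2 : eff (fun p (z : X * nat * nat) => s p z.1.1) by apply: (eff_call1 es); eff.
  by rewrite /gridvec /gridbase; eff.
Qed.

Lemma eff_enum_compl (e n : baire -> X -> nat) : eff e -> eff n ->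
  eff (fun p x => enum_compl (component p (i p x)) (N p x) (e p x) (n p x)).
Proof.
move=> ee en; apply: eff_if; first by apply: eff_excluded => //; eff.
  by rewrite /code_below /code_above; eff.
by eff.
Qed.

End EffEnum.

Section EnumCorrect.
Variable R : realType.

Lemma code_belowE s c : realq R (code_below s c) = realq R c - 2^-1 ^+ s.
Proof.
rewrite /realq -(ratr_half R s) -rmorphB; congr ratr.
rewrite /code_below rat_of_code_cpair rat_of_codeE prednK ?muln_gt0 ?expn_gt0 //.
rewrite exprVn !(natrD, natrM, natrX).
have : (csnd c).+1%:R != 0 :> rat by rewrite pnatr_eq0.
have : (2%:R : rat) ^+ s != 0 by rewrite expf_neq0.
move: (2%:R ^+ s) (csnd c).+1%:R => u v u0 v0; field.
by rewrite u0 v0.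
Qed.

Lemma code_aboveE s c : realq R (code_above s c) = realq R c + 2^-1 ^+ s.
Proof.
rewrite /realq -(ratr_half R s) -rmorphD; congr ratr.
rewrite /code_above rat_of_code_cpair rat_of_codeE prednK ?muln_gt0 ?expn_gt0 //.
rewrite exprVn !(natrD, natrM, natrX).
have : (csnd c).+1%:R != 0 :> rat by rewrite pnatr_eq0.
have : (2%:R : rat) ^+ s != 0 by rewrite expf_neq0.
move: (2%:R ^+ s) (csnd c).+1%:R => u v u0 v0; field.
by rewrite u0 v0.
Qed.

Lemma realq_le_size c : `|realq R c| <= (code_size c)%:R.
Proof.
rewrite /realq rat_of_codeE rmorphM /= fmorphV /= rmorphB /= !ratr_nat normrM.
rewrite normrV ?unitfE ?pnatr_eq0 // normr_nat ler_pdivrMr ?ltr0Sn //.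
rewrite (le_trans (ler_normB _ _)) // !normr_nat -natrD -natrM ler_nat.
by rewrite leq_pmulr.
Qed.

Variables (q : baire) (f : {poly R}) (N e : nat).
Hypotheses (qf : poly_names q f) (eN : (e < 2 * N)%N).

Lemma pcoef_near s k : `|ratr (pcoef q s k) - f`_k| <= 2^-1 ^+ s.
Proof.
case: qf => sf hf; rewrite /pcoef /pcode; case: leqP => kq.
  by rewrite ltW // exprVn; exact: hf.
rewrite nth_default ?(leq_trans sf) // -/(realq R 0) realq0 subrr normr0.
by rewrite ltW // half_exp_gt0.
Qed.

Lemma coef_bound s k : (k <= N)%N ->
  `|f`_k| <= (pbound q N)%:R /\ `|ratr (pcoef q s k) : R| <= (pbound q N)%:R.
Proof.
move=> kN; set S := code_size (pcode q 0 k).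
have SB : (S + 2)%:R <= (pbound q N)%:R :> R.
  rewrite ler_nat /pbound addnC leq_add2l (bigD1_seq k) ?iota_uniq ?mem_index_iota //=.
  exact: leq_addr.
have hS := realq_le_size (pcode q 0 k); rewrite -/S -/(pcoef q 0 k) in hS.
have h0 := pcoef_near 0 k; have hs := pcoef_near s k; rewrite expr0 in h0.
have hs1 : 2^-1 ^+ s <= 1 :> R by rewrite exprn_ile1 // invf_le1 // ler1n.
rewrite natrD in SB.
have fk : `|f`_k| <= S%:R + 1.
  rewrite -[f`_k](subrK (ratr (pcoef q 0 k))) addrC (le_trans (ler_normD _ _)) //.
  by rewrite lerD // distrC.
split; first by rewrite (le_trans fk) // (le_trans _ SB) // lerD2l ler1n.
rewrite -[ratr _](subrK f`_k) (le_trans (ler_normD _ _)) // (le_trans _ SB) //.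
by move: hs hs1 fk; lra.
Qed.

Lemma defect_approx s g c x y : (forall k, `|y k| <= 1) ->
  (forall k, (k < 3 * N)%N -> `|y k - ratr (gridvec s g k)| <= 2^-1 ^+ s) ->
  0 <= x <= 1 -> (0 <= rat_of_code c <= 1)%R -> `|x - realq R c| <= 2^-1 ^+ s ->
  `|defect (fun i => f`_i) y N e x -
    ratr (defect (pcoef q s) (gridvec s g) N e (rat_of_code c))| <=
  (lipK N (pbound q N))%:R * 2^-1 ^+ s.
Proof.
move=> y1 yg /andP[x0 x1] /andP[c0 c1] xc; rewrite -ratr_defect.
have d0 : 0 <= 2^-1 ^+ s :> R by rewrite ltW // half_exp_gt0.
have [|||_ _ //] := @near_by_defect R _ d0 N (pbound q N) (fun i => f`_i)
    (ratr \o pcoef q s) y (ratr \o gridvec s g) (pbound_gt0 q N) _ _ e x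
      (ratr (rat_of_code c)) eN.
- move=> i iN; have [h1 h2] := coef_bound s iN; split=> //.
  by rewrite distrC (le_trans (pcoef_near s i)) // ler_peMl // ler1n pbound_gt0.
- by move=> k kN; split; rewrite ?mul1r ?gridvec_le1 ?yg.
- split; rewrite ?mul1r //; first by rewrite ger0_norm.
  by rewrite -ratr_norm ger0_norm // -(rmorph1 ratr) ler_rat.
Qed.

Lemma enum_compl_names (A : closed_unit R) :
  sval A = inst_set f N e -> closed_names (enum_compl q N e) A.
Proof.
move=> AE x x01; rewrite AE; split=> [nA|[n]].
  have [s hs] : exists s, forall y, (forall k, `|y k| <= 1) ->
      2 * (lipK N (pbound q N))%:R * 2^-1 ^+ s < defect (fun i => f`_i) y N e x.
    apply: (defect_separated (pbound_gt0 q N)) => // [i iN|y y1].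
      by have [] := coef_bound 0 iN.
    by apply/eqP => dy; apply: nA; split=> //; exists y.
  have [j js jx] := grid_near s x01.
  pose c := cpair (cpair j 0) (2 ^ s).-1.
  have cE : rat_of_code c = grid s j.
    by rewrite rat_of_code_cpair prednK ?expn_gt0 // subr0 /grid natrX exprVn.
  have c01 : (0 <= rat_of_code c <= 1)%R.
    rewrite cE -2!(ler_rat R) rmorph0 rmorph1 ratr_grid.
    have h := half_exp_gt0 R s; apply/andP; split; first by rewrite mulr_ge0 // ltW.
    by rewrite -[X in _ <= X](half_expM R s) ler_pM2r // ler_nat.
  have xc : `|x - realq R c| < 2^-1 ^+ s by rewrite distrC /realq cE ratr_grid.
  exists (cpair s c); rewrite /enum_compl cfst_pair csnd_pair.
  have -> : excluded q N e s c.
    rewrite /excluded andbA c01 /=; apply/allP => g _.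
    rewrite -(ltr_rat R) rmorphM /= ratr_half ratr_nat.
    (* The separation is applied to the grid vector itself; rounding [x] and the coefficients loses
       one half of the bound, and the other half passes the test. *)
    have g1 k : `|(ratr \o gridvec s g) k : R| <= 1 by exact: gridvec_le1.
    have gg k : (k < 3 * N)%N ->
        `|(ratr \o gridvec s g) k - ratr (gridvec s g k)| <= 2^-1 ^+ s :> R.
      by move=> _; rewrite subrr normr0 ltW // half_exp_gt0.
    have := hs _ g1; have := defect_approx g1 gg x01 c01 (ltW xc).
    rewrite -mulrA; move: (_%:R * 2^-1 ^+ s) => Lh; rewrite ler_norml => /andP[_ h1] h2.
    by move: h1 h2; lra.
  rewrite cfst_pair csnd_pair code_belowE code_aboveE.
  by move: xc; rewrite ltr_norml => /andP[? ?]; apply/andP; split; lra.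
rewrite /enum_compl; case: ifP => [|_]; last first.
  by rewrite cfst_pair csnd_pair => /andP[a b]; have := lt_trans a b; rewrite ltxx.
set s := cfst n; set c := csnd n => /and3P[c0 c1 /allP ex].
rewrite cfst_pair csnd_pair code_belowE code_aboveE => /andP[xl xr] [_ [y [y1 dy]]].
(* A true zero [y] would be rounded to a grid vector at which the defect is too small for the
   test. *)
have [g gM gy] := gridvec_near s (3 * N) y1.
have := ex g; rewrite mem_iota0 => /(_ gM).
rewrite -(ltr_rat R) rmorphM /= ratr_half ratr_nat ltNge => /negP; apply.
have yg k : (k < 3 * N)%N -> `|y k - ratr (gridvec s g k)| <= 2^-1 ^+ s.
  by move=> kN; rewrite distrC gy.
have c01 : (0 <= rat_of_code c <= 1)%R by rewrite c0 c1.
have xc : `|x - realq R c| <= 2^-1 ^+ s.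
  by rewrite ler_norml; apply/andP; split; lra.
have := defect_approx y1 yg x01 c01 xc; rewrite dy sub0r normrN.
exact: le_trans (ler_norm _).
Qed.

End EnumCorrect.

(** A common [N] for all polynomials of the tuple, so that an instance number splits by division by
    [2 N]. The successor keeps [N] positive. *)
Definition degree_sum (p : baire) : nat :=
  (\sum_(0 <= i < p 0) component p i 0).+1.

Lemma component_le_sum p i : (i < p 0)%N -> (component p i 0 < degree_sum p)%N.
Proof.
move=> ip; rewrite ltnS (bigD1_seq i) ?iota_uniq ?mem_index_iota //=.
exact: leq_addr.
Qed.

Lemma inst_closed (R : realType) (f : {poly R}) N e :
  (size f <= N.+1)%N -> (e < 2 * N)%N ->
  closed (inst_set f N e) /\ inst_set f N e `<=` [set` `[(0 : R), 1]].
Proof.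
move=> sf eN; split; last by move=> x []; rewrite /= in_itv.
have [->|[a ->]] := inst_setP sf eN; first exact: interval_closed.
exact/accessible_closed_set1/hausdorff_accessible/Rhausdorff.
Qed.

Definition to_closed_unit (R : realType) (A : set R)
    (hA : closed A /\ A `<=` [set` `[(0 : R), 1]]) : closed_unit R := exist _ A hA.

Lemma full_closed (R : realType) :
  closed [set` `[(0 : R), 1]] /\ [set` `[(0 : R), 1]] `<=` [set` `[(0 : R), 1]].
Proof. by split=> //; exact: interval_closed. Qed.

Definition evens (b : baire) : baire := fun n => b (2 * n)%N.
Definition odds (b : baire) : baire := fun n => b (2 * n).+1.

Lemma evens_bpair p q : evens (bpair p q) = p.
Proof. by apply/funext => n; rewrite /evens /bpair mul2n odd_double half_double. Qed.

Lemma odds_bpair p q : odds (bpair p q) = q.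
Proof. by apply/funext => n; rewrite /odds /bpair mul2n /= odd_double uphalf_double.
Qed.

(** The approximation of [t_j] at position [2] errs by less than [1/4], so its comparison with [1/2]
    certifies [t_j > 1/4] or [t_j < 3/4]. *)
Definition choice_bit (q : baire) (N i j : nat) : bool :=
  2^-1 <= rat_of_code (component q (i * (2 * N) + (N + j))%N 2).

(** Each root is copied from the answer to a candidate instance and only its index is computed. The
    original input supplies the length of the tuple and [N]. *)
Definition select (p q : baire) : baire := fun x =>
  if x == 0%N then p 0%N else
  let N := degree_sum p in
  let i := cfst x.-1 in
  component q (i * (2 * N) + last_true (choice_bit q N i) N)%N (csnd x.-1).

Lemma eff_select : eff (fun b x => select (evens b) (odds b) x).
Proof.
have eN (Y : Type) (nY : numbered Y) : eff (fun b (_ : Y) => degree_sum (evens b)).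
  by apply: eff_succ; rewrite /component /evens; eff.
have eo (Y : Type) (nY : numbered Y) (i n : baire -> Y -> nat) : eff i -> eff n ->
    eff (fun b z => component (odds b) (i b z) (n b z)).
  by move=> ei en; rewrite /component /odds; eff.
apply: eff_if; [by eff|by rewrite /evens; eff|].
apply: (eo _ _); last by eff.
have eNx := eN nat _.
apply: eff_addn; first by apply: eff_muln; [eff|apply: eff_muln; eff].
apply: (eff_nat_rect (T := nat)); [by eff| |exact: eNx].
apply: eff_if; [|by eff|by eff].
apply: eff_ler; first by eff.
apply: eff_rat_of_code; apply: (eo _ _); last by eff.
have eNz := eN (nat * (nat * nat))%type _.
by do ![apply: eff_addn|apply: eff_muln|exact: eNz|eff_all_step].
Qed.

Lemma BRoot_le_AoUC (R : realType) :
  weihrauch_le (star (@BRoot R)) (star (@AoUC R)).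
Proof.
(* Component [E] of the query is instance [E %% (2 * N)] of polynomial number [E %/ (2 * N)]. *)
pose K p x := if x == 0%N then (p 0 * (2 * degree_sum p))%N else
  enum_compl (component p (cfst x.-1 %/ (2 * degree_sum p))) (degree_sum p)
    (cfst x.-1 %% (2 * degree_sum p)) (csnd x.-1).
exists (fun b => Some (select (evens b) (odds b))), (fun p => Some (K p)).
have eN : eff (fun p (_ : nat) => degree_sum p).
  by apply: eff_succ; apply: (eff_sumn (h := fun p _ => p 0%N)); eff.
split; first exact/eff_computable/eff_select.
  apply: eff_computable; apply: eff_if; [by eff|by eff|].
  by apply: (eff_enum_compl (i := fun p x => (cfst x.-1 %/ (2 * degree_sum p))%N)
    (N := fun p _ => degree_sum p)); eff.
move=> G realG p fs [p0 hp] _; set N := degree_sum p.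
have N0 : (0 < N)%N by [].
have sfN i f : onth fs i = Some f -> (size f <= N.+1)%N.
  move=> fi; have ip : (i < p 0)%N by rewrite p0 (onth_lt fi).
  have [sf' _] := hp _ _ fi; rewrite (leq_trans sf') // ltnS.
  exact: ltnW (component_le_sum ip).
have eN2 E : (E %% (2 * N) < 2 * N)%N by rewrite ltn_mod muln_gt0.
have /choice[F hF] E : exists A : closed_unit R, forall f : {poly R},
    onth fs (E %/ (2 * N)) = Some f -> sval A = inst_set f N (E %% (2 * N)).
  case fE : (onth fs _) => [f|]; last by exists (to_closed_unit (full_closed R)).
  have sf := sfN _ _ fE.
  by exists (to_closed_unit (inst_closed sf (eN2 E))) => _ [<-].
pose zs : star_space (closed_space R) := mkseq F (size fs * (2 * N)).
have div_lt E : (E < size fs * (2 * N))%N -> (E %/ (2 * N) < size fs)%N.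
  by rewrite ltn_divLR // muln_gt0.
have zsK : star_names (K p) zs.
  split; first by rewrite size_mkseq /K /= p0.
  move=> E A; rewrite onth_mkseq; case: ltnP => // Ez [<-].
  have [f fE] := onth_ex (div_lt _ Ez); have sf := sfN _ _ fE.
  have -> : component (K p) E =
      enum_compl (component p (E %/ (2 * N))) N (E %% (2 * N)).
    by apply/funext => n; rewrite /component /K /= -/N cfst_pair csnd_pair.
  exact: (enum_compl_names (hp _ _ fE) (eN2 E) (hF _ _ fE)).
have zdom : mdom (star (@AoUC R)) zs.
  apply: star_dom => E A; rewrite onth_mkseq; case: ltnP => // Ez [<-].
  have [f fE] := onth_ex (div_lt _ Ez); have sf := sfN _ _ fE.
  have AE := hF _ _ fE.
  have [a Aa] : exists a, sval (F E) a.
    rewrite AE; have [->|[a ->]] := inst_setP sf (eN2 E); last by exists a.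
    by exists 0; rewrite /= in_itv /= lexx ler01.
  have a01 : 0 <= a <= 1 by move: Aa; rewrite AE => -[].
  exists (exist _ a a01); split=> //.
  by rewrite AE; exact: inst_setP.
have [q [ws [Gq qws /Forall2_onth[szw zws]]]] := realG _ _ zsK zdom.
rewrite size_mkseq in szw.
have h01 : 0 <= (0 : R) <= 1 by rewrite lexx ler01.
pose w E : unit_space R := nth (exist _ 0 h01) ws E.
have wE E : (E < size fs * (2 * N))%N -> onth ws E = Some (w E).
  by rewrite szw => Ew; have [x xE] := onth_ex Ew; rewrite xE /w (onth_nth _ _ _ _ xE).
pose J i := (i * (2 * N) + last_true (choice_bit q N i) N)%N.
have idx i j : (i < size fs)%N -> (j < 2 * N)%N ->
    [/\ (i * (2 * N) + j < size fs * (2 * N))%N, ((i * (2 * N) + j) %/ (2 * N) = i)%N &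
    ((i * (2 * N) + j) %% (2 * N) = j)%N].
  move=> ifs jN; have D : ((i * (2 * N) + j) %/ (2 * N) = i)%N.
    by rewrite divnMDl ?muln_gt0 // divn_small // addn0.
  have N2 : (0 < 2 * N)%N by rewrite muln_gt0.
  by split=> //;
    [have := ltn_divLR (i * (2 * N) + j) (size fs) N2;
      rewrite D ifs => <-|rewrite modnMDl modn_small].
have wset i j f : onth fs i = Some f -> (j < 2 * N)%N ->
    inst_set f N j (sval (w (i * (2 * N) + j)%N)).
  move=> fi jN; have [Ez D M] := idx i j (onth_lt fi) jN.
  have [_] := zws _ _ _ (etrans (onth_mkseq F _ _) (ifT _ _ Ez)) (wE _ Ez).
  by rewrite (hF _ f) ?M ?D.
exists (select p q), (mkseq (fun i => w (J i)) (size fs)); split.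
- by rewrite /= Gq /= evens_bpair odds_bpair.
- split; first by rewrite size_mkseq.
  move=> i x; rewrite onth_mkseq; case: ltnP => // ifs [<-].
  have -> : component (select p q) i = component q (J i).
    by apply/funext => n; rewrite {1}/component /select /= cfst_pair csnd_pair.
  case: qws => _; apply; apply: wE.
  have pN : (last_true (choice_bit q N i) N < 2 * N)%N by have := last_true_lt
    (choice_bit q N i) N0; lia.
  by have [] := idx _ _ ifs pN.
apply/Forall2_onth; split; first by rewrite size_mkseq.
move=> i f x fi; rewrite onth_mkseq (onth_lt fi) => -[<-] [z z01 fz].
(* For [f = 0] the answers for different candidates need not fit one factorisation, but every point
   is a root. *)
have [->|f0] := eqVneq f 0; first by rewrite /root horner0.
have sf := sfN _ _ fi.
apply: (@root_last_true R f N sf (choice_bit q N i)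
  (fun j => sval (w (i * (2 * N) + j)%N))
  (fun j => sval (w (i * (2 * N) + (N + j))%N)) z f0 z01 fz) => j jN.
- by apply: wset => //; lia.
- by apply: wset => //; lia.
have N2 : (N + j < 2 * N)%N by lia.
have [Ez _ _] := idx _ _ (onth_lt fi) N2.
have := qws.2 _ _ (wE _ Ez) 2%N; rewrite /choice_bit -(ler_rat R) fmorphV /= ratr_nat.
rewrite -/(realq R _); move: (realq R _) (sval _) => r t; rewrite ltr_norml => /andP[].
have -> : 2 ^- 2 = 4^-1 :> R by rewrite -natrX.
by move=> h1 h2; case: (leP 2^-1 r) => h3; lra.
Qed.

Theorem theorem2 (R : realType) :
  weihrauch_equiv (star (@AoUC R)) (star (@BRoot R)).
Proof. by split; [exact: AoUC_le_BRoot|exact: BRoot_le_AoUC]. Qed.
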